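(* Let $N\geq2$ be an integer and let $X\in\mathrm{Mat}_N$ be a hermitian matrix. Let $\tau=20$ and $\theta=2^{100}$. Let $$\mathcal R=\left\{z\in\mathfrak h\ \Big|\ |\Re z|\leq4\ \text{and}\ \tfrac1N\leq\Im z\leq\tau\right\},\qquad K=\sup_{z\in\mathcal R}\mathfrak K(z)<\infty,$$ $$\mathcal X=\left\{z\in\mathcal R\ \Big|\ \frac{2^8\theta^2K^2}{N}\leq h(z)^2\,\Im z\right\}$$ (a closed, possibly empty set). Then $$z\in\mathcal X\ \Longrightarrow\ \max_{1\le i\le N}|G_i-m|\leq\frac{\theta K}{\sqrt{N\,h(z)\,\Im z}}.$$ Here $\mathfrak K(z)$, $G_i$, $m$, $h(z)$ (all depending on $z$) are as defined in the context.
   Context: Notation. $x\vee y=\max(x,y)$, $x\wedge y=\min(x,y)$; $\mathfrak h=\{z\in\mathbb C:\Im z>0\}$; $\mathrm{Mat}_N$ is the space of $N\times N$ complex matrices, $I_N$ the identity; $\|A\|_2=(\mathrm{tr}\,AA^* )^{1/2}$. Let $e_i$ be the $i$th row of $I_N$ and $\hat e_i$ the result of deleting the $i$th row of $I_N$. For $z\in\mathfrak h$ and $i=1,\dots,N$ let $$R=(X-zI_N)^{-1},\quad G_i=e_iRe_i^*=R(i,i),\quad R_i=(\hat e_iX\hat e_i^*-zI_{N-1})^{-1}\in\mathrm{Mat}_{N-1},\quad \widehat G_i=\frac1N\mathrm{tr}\,R_i,$$ $$Q_i=e_iX\hat e_i^*R_i\hat e_iXe_i^*-X(i,i)-\widehat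 G_i\in\mathbb C,$$ $$m=\frac1{2\pi}\int_{-2}^2\frac{\sqrt{4-t^2}\,dt}{t-z}\in\mathfrak h\quad(\text{equivalently } m\in\mathfrak h,\ z=-m^{-1}-m),\qquad h=h(z)=1\wedge|z+2|\wedge|z-2|,$$ $$\mathfrak K=\mathfrak K(z)=1\vee\max_{1\le i\le N}\frac{|Q_i|}{\frac1{\sqrt N}\left(1\vee\frac{\|R_i\|_2}{\sqrt N}\right)}.$$ All of these depend on $z$. *)

(* Defs.v *)
From HB Require Import structures.
From mathcomp Require Import all_boot all_order all_algebra.
From mathcomp Require Import all_classical all_reals all_analysis.
From mathcomp Require Import complex.

Set Implicit Arguments.
Unset Strict Implicit.
Unset Printing Implicit Defensive.

Import Order.TTheory GRing.Theory Num.Theory.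
Import numFieldNormedType.Exports.

Local Open Scope classical_set_scope.
Local Open Scope sesquilinear_scope.
Local Open Scope complex_scope.
Local Open Scope ring_scope.

(* The modulus with values in R; the generic norm on R[i] is R[i]-valued:
   `|z| = (cabs z)%:C. *)
Notation cabs := Normc.normc.

(* The Hilbert-Schmidt norm; tr (A A^* ) is a nonnegative real. *)
Definition hsnorm (R : realType) (n : nat) (A : 'M[R[i]]_n) : R :=
  Num.sqrt (complex.Re (\tr (A *m A ^t*))).

Definition upper_half_plane (R : realType) : set R[i] :=
  [set z | 0 < complex.Im z].

Definition evec (R : realType) (N : nat) (i : 'I_N) : 'rV[R[i]]_N :=
  row i 1%:M.

Definition hevec (R : realType) (N : nat) (i : 'I_N) : 'M[R[i]]_(N.-1, N) :=
  row' i 1%:M.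

Section Resolvents.
Variables (R : realType) (N : nat) (X : 'M[R[i]]_N).

Definition resolvent (z : R[i]) : 'M[R[i]]_N := invmx (X - z%:M).

Definition diagG (z : R[i]) (i : 'I_N) : R[i] :=
  (evec R i *m resolvent z *m (evec R i) ^t*) 0 0.

Definition minor_resolvent (z : R[i]) (i : 'I_N) : 'M[R[i]]_N.-1 :=
  invmx (hevec R i *m X *m (hevec R i) ^t* - z%:M).

(* The normalisation is 1/N, although the matrix has size N - 1. *)
Definition hatG (z : R[i]) (i : 'I_N) : R[i] :=
  N%:R^-1 * \tr (minor_resolvent z i).

Definition Qerr (z : R[i]) (i : 'I_N) : R[i] :=
  (evec R i *m X *m (hevec R i) ^t* *m minor_resolvent z i
     *m hevec R i *m X *m (evec R i) ^t*) 0 0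
  - X i i - hatG z i.

(* The unit of the iterated maximum supplies the outer "1 \/". *)
Definition frakK (z : R[i]) : R :=
  \big[Num.max/1]_(i < N)
    (cabs (Qerr z i) /
      ((Num.sqrt N%:R)^-1 *
       Num.max 1 (hsnorm (minor_resolvent z i) / Num.sqrt N%:R))).

End Resolvents.

(* A complex-valued integral is computed componentwise. *)
Definition Cintegral (R : realType) (D : set R) (f : R -> R[i]) : R[i] :=
  (\int[@lebesgue_measure R]_(t in D) complex.Re (f t))%R
  +i* (\int[@lebesgue_measure R]_(t in D) complex.Im (f t))%R.

Definition semicircle_m (R : realType) (z : R[i]) : R[i] :=
  ((2 * pi)^-1)%:C *
  Cintegral `[(-2 : R), 2]
    (fun t => (Num.sqrt (4 - t ^+ 2))%:C / (t%:C - z)).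

Definition edge_h (R : realType) (z : R[i]) : R :=
  Num.min 1 (Num.min (cabs (z + 2)) (cabs (z - 2))).

Definition tau (R : realType) : R := 20.
Definition theta (R : realType) : R := 2 ^+ 100.

Definition calR (R : realType) (N : nat) : set R[i] :=
  [set z | [/\ upper_half_plane z, `|complex.Re z| <= 4 &
            N%:R^-1 <= complex.Im z <= tau R]].

Definition frakK_range (R : realType) (N : nat) (X : 'M[R[i]]_N) : set R :=
  [set frakK X z | z in @calR R N].

(* [sup] on R returns 0 for an unbounded set, so finiteness of this supremum
   has to be stated separately, as [has_sup (frakK_range X)]. *)
Definition supK (R : realType) (N : nat) (X : 'M[R[i]]_N) : R :=
  sup (frakK_range X).

Definition calX (R : realType) (N : nat) (X : 'M[R[i]]_N) : set R[i] :=
  [set z | @calR R N z /\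
     2 ^+ 8 * theta R ^+ 2 * supK X ^+ 2 / N%:R <= edge_h z ^+ 2 * complex.Im z].

(* Main.v *)
Require Import Defs.
From HB Require Import structures.
From mathcomp Require Import all_boot all_order all_algebra.
From mathcomp Require Import all_classical all_reals all_analysis.
From mathcomp Require Import complex.
From mathcomp Require Import ring lra.

(** Write [eta] for the imaginary part of [z], [s] for the normalised trace of
    the resolvent, [m] for the value of the semicircle integral and [h] for
    [edge_h], the distance from [z] to the edges, capped at one.

    Removing the [i]-th row and column of [X] and taking a Schur complement
    gives the exact formula [G_i = - (z + hatG_i + Q_i)^-1]
    ([diagGE], [schur_denomE]).  Passing from [X] to a minor changes the trace
    of the resolvent by at most [eta^-1] ([trace_diff_le]), so [hatG_i] may be
    replaced by [s]; and the Ward identity turns the Hilbert-Schmidt norm that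
    controls [Q_i] into [Im hatG_i / eta] ([hsnorm_resolvent]).  Hence
    [G_i = - (z + s + e_i)^-1] with [|e_i| <= 6 K / sqrt (N eta)] as soon as
    [s] is bounded ([self_error_le]).

    On the other side [m] solves [z = - (m + m^-1)] with [|m| < 1]
    ([semicircle_spec]).  The integral is computed from an explicit
    antiderivative, so that its values at the two edges give [2 pi m].

    Averaging the equations for the [G_i] yields
    [(s - m) (s - m^-1) = s^2 + z s + 1 = O(max |e_i|)].  Since
    [|m - m^-1|^2 = |z^2 - 4| >= h], the factor [s - m^-1] is of size at least
    [sqrt h] whenever [s] lies within [sqrt h / 8] of [m]; then [s], and
    after it every [G_i], is within [O(max |e_i| / sqrt h)] of [m]
    ([self_consistent_stability]).  On the admissible set this conclusion is
    far stronger than the assumption [|s - m| <= sqrt h / 8], so equality in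
    the latter is impossible ([admissible_gap]).  The assumption holds when
    [eta = 20], where both [s] and [m] are at most [1 / 20]; the admissible set
    is closed under moving up to that height, as [h] and [eta] increase; and
    [64 |s - m|^2 - h] is continuous along the vertical ray.  By the
    intermediate value theorem the assumption therefore holds on the
    whole ray ([admissible_law]).

    Finiteness of the supremum follows from the bound [eta^-1 <= N] on the
    entries of the minor resolvents, and closedness of the admissible set
    from the continuity of the functions in its definition. *)

Set Implicit Arguments.
Unset Strict Implicit.
Unset Printing Implicit Defensive.

Import Order.TTheory GRing.Theory Num.Theory.
Import numFieldNormedType.Exports.
Local Open Scope classical_set_scope.
Local Open Scope sesquilinear_scope.
Local Open Scope complex_scope.
Local Open Scope ring_scope.

(** * Modulus, real and imaginary parts of complex numbers *)

Section Modulus.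
Variable R : realType.
Implicit Types x y z : R[i].

Lemma cabsD x y : cabs (x + y) <= cabs x + cabs y.
Proof. exact: le_normcD. Qed.

Lemma cabsN x : cabs (- x) = cabs x.
Proof. exact: normcN. Qed.

Lemma cabsB x y : cabs (x - y) <= cabs x + cabs y.
Proof. by rewrite -(cabsN y) cabsD. Qed.

Lemma cabs_ge0 x : 0 <= cabs x.
Proof. by case: x => a b; exact: sqrtr_ge0. Qed.

Lemma cabs_sqr x : cabs x ^+ 2 = complex.Re x ^+ 2 + complex.Im x ^+ 2.
Proof. by case: x => a b /=; rewrite sqr_sqrtr// addr_ge0// sqr_ge0. Qed.

Lemma Re_le_cabs x : `|complex.Re x| <= cabs x.
Proof.
by case: x => a b /=; rewrite -sqrtr_sqr ler_wsqrtr // lerDl sqr_ge0.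
Qed.

Lemma Im_le_cabs x : `|complex.Im x| <= cabs x.
Proof.
by case: x => a b /=; rewrite -sqrtr_sqr ler_wsqrtr // lerDr sqr_ge0.
Qed.

Lemma cabs_conj x : cabs (x^* )%C = cabs x.
Proof. by case: x => a b /=; rewrite sqrrN. Qed.

Lemma cabsR (a : R) : cabs a%:C = `|a|.
Proof. by rewrite /= expr0n addr0 sqrtr_sqr. Qed.

Lemma cabs_nat n : cabs (n%:R : R[i]) = n%:R.
Proof. by rewrite -[n%:R](rmorph_nat (real_complex R)) cabsR ger0_norm. Qed.

Lemma cabs_eq0 x : (cabs x == 0) = (x == 0).
Proof.
apply/eqP/eqP => [/Normc.eq0_normc //|->]; exact: Normc.normc0.
Qed.

Lemma cabs_gt0 x : (0 < cabs x) = (x != 0).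
Proof. by rewrite lt_def cabs_ge0 andbT cabs_eq0. Qed.

Lemma ReD x y : complex.Re (x + y) = complex.Re x + complex.Re y.
Proof. by case: x; case: y. Qed.

Lemma ImD x y : complex.Im (x + y) = complex.Im x + complex.Im y.
Proof. by case: x; case: y. Qed.

Lemma ReB x y : complex.Re (x - y) = complex.Re x - complex.Re y.
Proof. by case: x; case: y. Qed.

Lemma ImB x y : complex.Im (x - y) = complex.Im x - complex.Im y.
Proof. by case: x; case: y. Qed.

Lemma ReZ (a : R) x : complex.Re (a%:C * x) = a * complex.Re x.
Proof. by case: x => b c /=; rewrite mul0r subr0. Qed.

Lemma ImZ (a : R) x : complex.Im (a%:C * x) = a * complex.Im x.
Proof. by case: x => b c /=; rewrite mul0r addr0. Qed.

Lemma mul_conj x : x * (x^* )%C = (cabs x ^+ 2)%:C.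
Proof.
rewrite cabs_sqr; case: x => a b; apply/eqP; rewrite eq_complex /=.
by apply/andP; split; apply/eqP; ring.
Qed.

Lemma cabs_sum (I : finType) (P : pred I) (F : I -> R[i]) :
  cabs (\sum_(i | P i) F i) <= \sum_(i | P i) cabs (F i).
Proof.
elim/big_ind2 : _ => [|x1 y1 x2 y2 h1 h2|//]; first by rewrite Normc.normc0.
by apply: (le_trans (cabsD _ _)); rewrite lerD.
Qed.

End Modulus.

(** * Resolvents of hermitian matrices *)

Section HermitianResolvent.
Variables (R : realType) (n : nat).
Implicit Types (H : 'M[R[i]]_n) (z : R[i]).

Definition rowsq (v : 'rV[R[i]]_n) : R := \sum_j cabs (v 0 j) ^+ 2.

Lemma rowsq_ge0 v : 0 <= rowsq v.
Proof. by apply: sumr_ge0 => j _; exact: sqr_ge0. Qed.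

Lemma rowsqE v : (v *m v ^t*) 0 0 = (rowsq v)%:C.
Proof.
rewrite mxE rmorph_sum; apply: eq_bigr => j _.
by rewrite !mxE; exact: mul_conj.
Qed.

Lemma rowsq_eq0 v : (rowsq v == 0) = (v == 0).
Proof.
rewrite psumr_eq0; last by move=> j _; exact: sqr_ge0.
apply/allP/eqP => [v0|-> j _]; last first.
  by rewrite implyTb mxE Normc.normc0 expr0n.
apply/rowP => j; rewrite mxE; apply: Normc.eq0_normc; apply/eqP.
by have := v0 j (mem_index_enum j); rewrite implyTb sqrf_eq0.
Qed.

Lemma trCmul m p q (A : 'M[R[i]]_(m, p)) (B : 'M[R[i]]_(p, q)) :
  (A *m B) ^t* = B ^t* *m A ^t*.
Proof. by rewrite trmx_mul map_mxM. Qed.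

Lemma trCB m p (A B : 'M[R[i]]_(m, p)) : (A - B) ^t* = A ^t* - B ^t*.
Proof. by apply/matrixP=> i j; rewrite !mxE rmorphB. Qed.

Lemma hermsymmxE (H : 'M[R[i]]_n) : H \is hermsymmx -> H ^t* = H.
Proof. by move/is_hermitianmxP => h; rewrite {2}h expr0 scale1r. Qed.

(** If [v] is in the kernel of [H - z], then [v H v^*] equals [z |v|^2]; it is
    real because [H] is hermitian, and [z] is not, so [v] vanishes. *)
Lemma shift_unit H z : H ^t* = H -> 0 < complex.Im z -> H - z%:M \in unitmx.
Proof.
move=> hH z0; rewrite -row_free_unit -kermx_eq0; apply/rowV0P => v /sub_kermxP.
rewrite mulmxBr mul_mx_scalar => /eqP; rewrite subr_eq0 => /eqP vH.
apply/eqP; rewrite -rowsq_eq0.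
have h1 : (v *m H *m v ^t*) 0 0 = z * (rowsq v)%:C.
  by rewrite vH -scalemxAl mxE rowsqE.
have h2 : (v *m H *m v ^t*) 0 0 = ((z * (rowsq v)%:C)^* )%C.
  rewrite -h1.
  have : (v *m H *m v ^t*) ^t* = v *m H *m v ^t*.
    by rewrite !trCmul hH trmxCK mulmxA.
  by move/matrixP/(_ 0 0); rewrite 2!mxE => {1}<-.
have : complex.Im (z * (rowsq v)%:C) = 0.
  have := congr1 (@complex.Im R) h2; rewrite h1.
  case: (z) (rowsq v) => a b c /=; lra.
rewrite mulrC ImZ => /eqP; rewrite mulf_eq0 => /orP[//|/eqP h].
by rewrite h ltxx in z0.
Qed.

Section Fixed.
Variables (H : 'M[R[i]]_n) (z : R[i]).
Hypotheses (hH : H ^t* = H) (hz : 0 < complex.Im z).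
Let S := invmx (H - z%:M).
Let eta := complex.Im z.

Lemma shiftV : (H - z%:M) *m S = 1%:M.
Proof. by rewrite mulmxV// shift_unit. Qed.

Lemma Vshift : S *m (H - z%:M) = 1%:M.
Proof. by rewrite mulVmx// shift_unit. Qed.

Lemma shift_trC : (H - z%:M) ^t* = H - ((z^* )%C)%:M.
Proof.
by rewrite trCB hH; congr (_ - _); rewrite tr_scalar_mx map_scalar_mx.
Qed.

Lemma conj_diff : z - (z^* )%C = 2 * 'i * eta%:C.
Proof.
rewrite /eta; case: z => a b; apply/eqP; rewrite eq_complex /=.
by apply/andP; split; apply/eqP; ring.
Qed.

(** The Ward identity: it is the resolvent identity between the spectral
    parameters [z] and its conjugate. *)
Lemma ward : S - S ^t* = (2 * 'i * eta%:C) *: (S *m S ^t*).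
Proof.
have e1 : (H - ((z^* )%C)%:M) *m S ^t* = 1%:M.
  rewrite -shift_trC -trCmul Vshift; apply/matrixP=> i j.
  by rewrite !mxE eq_sym rmorph_nat.
have -> : S - S ^t* = S *m (H - ((z^* )%C)%:M - (H - z%:M)) *m S ^t*.
  by rewrite mulmxBr mulmxBl -mulmxA e1 mulmx1 Vshift mul1mx.
rewrite -conj_diff.
have -> : H - ((z^* )%C)%:M - (H - z%:M) = (z - (z^* )%C)%:M.
  by rewrite opprB addrC subrKA raddfB.
by rewrite mul_mx_scalar -scalemxAl.
Qed.

Lemma wardC : S - S ^t* = (2 * 'i * eta%:C) *: (S ^t* *m S).
Proof.
have e1 : S ^t* *m (H - ((z^* )%C)%:M) = 1%:M.
  rewrite -shift_trC -trCmul shiftV; apply/matrixP=> i j.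
  by rewrite !mxE eq_sym rmorph_nat.
have -> : S - S ^t* = S ^t* *m (H - ((z^* )%C)%:M - (H - z%:M)) *m S.
  by rewrite mulmxBr mulmxBl e1 mul1mx -mulmxA shiftV mulmx1.
rewrite -conj_diff.
have -> : H - ((z^* )%C)%:M - (H - z%:M) = (z - (z^* )%C)%:M.
  by rewrite opprB addrC subrKA raddfB.
by rewrite mul_mx_scalar -scalemxAl.
Qed.

(** Both Ward identities have the same left-hand side. *)
Lemma resolvent_normal : S *m S ^t* = S ^t* *m S.
Proof.
have c0 : 2 * 'i * eta%:C != 0 :> R[i].
  rewrite -conj_diff; apply/eqP => /(congr1 (@complex.Im R)).
  by move: hz; case: z => a b /=; lra.
by apply: (scalerI c0); rewrite -ward wardC.
Qed.

Lemma Im_of_conj_diff (a : R) (A : R[i]) c : A - (A^* )%C = (2 * 'i * a%:C) * c%:C ->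
  complex.Im A = a * c.
Proof. by case: A => x y [] /=; lra. Qed.

Lemma Im_quad (r : 'rV[R[i]]_n) :
  complex.Im ((r *m S *m r ^t*) 0 0) = eta * rowsq (r *m S).
Proof.
apply: Im_of_conj_diff; rewrite -rowsqE.
have <- : (r *m S ^t* *m r ^t*) 0 0 = (((r *m S *m r ^t*) 0 0)^* )%C.
  have -> : r *m S ^t* *m r ^t* = (r *m S *m r ^t*) ^t*.
    by rewrite !trCmul trmxCK mulmxA.
  by rewrite 2!mxE.
have -> (A B : 'M[R[i]]_1) : A 0 0 - B 0 0 = (A - B) 0 0 by rewrite !mxE.
rewrite -mulmxBl -mulmxBr ward -scalemxAr -scalemxAl mxE.
by rewrite trCmul !mulmxA.
Qed.

(** Cauchy-Schwarz bounds the left-hand side by the product of the norms of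
    [r S] and [r S^*], which agree because [S] is normal. *)
Lemma quad2_le (r : 'rV[R[i]]_n) :
  cabs ((r *m S *m S *m r ^t*) 0 0) <= rowsq (r *m S).
Proof.
have hsq : rowsq (r *m S ^t*) = rowsq (r *m S).
  suff: (rowsq (r *m S ^t*))%:C = (rowsq (r *m S))%:C by case.
  have e A : (r *m A) *m (r *m A) ^t* = r *m (A *m A ^t*) *m r ^t*.
    by rewrite trCmul !mulmxA.
  by rewrite -!rowsqE !e trmxCK resolvent_normal.
have -> : r *m S *m S *m r ^t* = (r *m S) *m (r *m S ^t*) ^t*.
  by rewrite trCmul trmxCK !mulmxA.
rewrite mxE; apply: (le_trans (cabs_sum _ _)).
apply: (@le_trans _ _ (2^-1 * (rowsq (r *m S) + rowsq (r *m S ^t*)))); last first.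
  by rewrite hsq; lra.
rewrite /rowsq -big_split mulr_sumr /=; apply: ler_sum => j _.
rewrite Normc.normcM [in X in _ * X]mxE [in X in _ * X]mxE cabs_conj.
set a := cabs _; set b := cabs _.
have := sqr_ge0 (a - b); nra.
Qed.

Lemma resolvent_row (i : 'I_n) :
  \sum_k cabs (S i k) ^+ 2 = complex.Im (S i i) / eta.
Proof.
have -> : complex.Im (S i i) = eta * \sum_k cabs (S i k) ^+ 2.
  apply: Im_of_conj_diff; have /matrixP/(_ i i) := ward; rewrite !mxE => ->.
  rewrite rmorph_sum; congr (_ * _); apply: eq_bigr => j _.
  by rewrite !mxE; exact: mul_conj.
by rewrite mulrC mulKf// gt_eqF.
Qed.

(** By the Ward identity [eta |S_ii|^2 <= Im S_ii <= |S_ii|]. *)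
Lemma resolvent_diag_le i : cabs (S i i) <= eta^-1.
Proof.
have h : cabs (S i i) ^+ 2 <= complex.Im (S i i) / eta.
  by rewrite -resolvent_row (bigD1 i)//= lerDl sumr_ge0// => k _; exact: sqr_ge0.
have := cabs_ge0 (S i i); rewrite le_eqVlt => /orP[/eqP <-|s0].
  by rewrite invr_ge0 ltW.
rewrite -(ler_pM2l s0) -expr2 (le_trans h)// ler_wpM2r ?invr_ge0 ?(ltW hz)//.
by apply: (le_trans (ler_norm _)); exact: Im_le_cabs.
Qed.

Lemma resolvent_le i j : cabs (S i j) <= eta^-1.
Proof.
rewrite -(@ler_pXn2r _ 2%N)// ?nnegrE ?cabs_ge0 ?invr_ge0 ?(ltW hz)//.
have h : cabs (S i j) ^+ 2 <= complex.Im (S i i) / eta.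
  by rewrite -resolvent_row (bigD1 j)//= lerDl sumr_ge0// => k _; exact: sqr_ge0.
rewrite (le_trans h)// expr2 ler_wpM2r ?invr_ge0 ?(ltW hz)//.
apply: (le_trans (ler_norm _)); apply: (le_trans (Im_le_cabs _)).
exact: resolvent_diag_le.
Qed.

Lemma hsnorm_resolvent : hsnorm S ^+ 2 = complex.Im (\tr S) / eta.
Proof.
rewrite /hsnorm.
have -> : \tr (S *m S ^t*) = (complex.Im (\tr S) / eta)%:C.
  rewrite /mxtrace.
  have -> : complex.Im (\sum_i S i i) = \sum_i complex.Im (S i i).
    by elim/big_ind2 : _ => // x1 y1 x2 y2 <- <-; rewrite ImD.
  rewrite mulr_suml rmorph_sum; apply: eq_bigr => i _.
  rewrite -resolvent_row mxE rmorph_sum; apply: eq_bigr => k _.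
  by rewrite !mxE; exact: mul_conj.
rewrite sqr_sqrtr//= divr_ge0 ?(ltW hz)//.
have -> : complex.Im (\sum_i S i i) = \sum_i complex.Im (S i i).
  by elim/big_ind2 : _ => // x1 y1 x2 y2 <- <-; rewrite ImD.
apply: sumr_ge0 => i _.
have := resolvent_row i => /(congr1 ( *%R^~ eta)); rewrite divfK ?gt_eqF// => <-.
by rewrite mulr_ge0 ?(ltW hz)// sumr_ge0// => k _; exact: sqr_ge0.
Qed.

End Fixed.
End HermitianResolvent.

(** * Schur complements and the trace of a minor *)

Section Schur.
Variables (R : realType) (N : nat) (X : 'M[R[i]]_N) (z : R[i]) (i : 'I_N).
Hypotheses (hX : X ^t* = X) (hz : 0 < complex.Im z).
Let e := evec R i.
Let f := hevec R i.
Let S := minor_resolvent X z i.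
Let M := X - z%:M.

Definition offrow : 'rV[R[i]]_N.-1 := e *m X *m f ^t*.
Let r := offrow.

(** The Schur complement of the minor in [X - z]; its inverse is the [i]-th
    diagonal entry of the resolvent. *)
Definition schur_denom : R[i] := X i i - z - (r *m S *m r ^t*) 0 0.
Let d := schur_denom.

Lemma trC1 p : (1%:M : 'M[R[i]]_p) ^t* = 1%:M.
Proof. by apply/matrixP=> a b; rewrite !mxE eq_sym rmorph_nat. Qed.

Lemma evec_full p (A : 'M[R[i]]_(N, p)) : e *m A = row i A.
Proof. by rewrite /e /evec -row_mul mul1mx. Qed.

Lemma full_evec p (A : 'M[R[i]]_(p, N)) : A *m e ^t* = col i A.
Proof.
rewrite -[RHS]trmxK tr_col; apply/colP => j; rewrite !mxE.
rewrite (bigD1 i)//= !mxE eqxx rmorph1 mulr1 big1 ?addr0// => k ki.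
by rewrite !mxE eq_sym (negPf ki) rmorph0 mulr0.
Qed.

Lemma evecK : e *m e ^t* = 1%:M.
Proof. by rewrite full_evec; apply/matrixP => a b; rewrite !mxE !ord1 !eqxx. Qed.

Lemma hevecK : f *m f ^t* = 1%:M.
Proof.
apply/matrixP => a b; rewrite !mxE (bigD1 (lift i b))//= !mxE eqxx rmorph1 mulr1.
rewrite (inj_eq (@lift_inj _ i)) big1 ?addr0// => k ki.
by rewrite !mxE [lift i b == k]eq_sym (negPf ki) rmorph0 mulr0.
Qed.

Lemma hevec_evec : f *m e ^t* = 0.
Proof.
rewrite full_evec; apply/matrixP => a b.
by rewrite !mxE eq_sym (negPf (neq_lift _ _)).
Qed.

Lemma evec_hevec : e *m f ^t* = 0.
Proof.
rewrite -[LHS]trmxCK trCmul trmxCK hevec_evec.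
by apply/matrixP => a b; rewrite !mxE rmorph0.
Qed.

Lemma evec_split : e ^t* *m e + f ^t* *m f = 1%:M.
Proof.
apply/matrixP => a b; rewrite mxE.
have -> : (1%:M : 'M[R[i]]_N) a b = (1%:M ^t* *m 1%:M) a b by rewrite mulmx1 trC1.
rewrite !mxE big_ord1 [RHS](bigD1_ord i)//=; congr (_ + _).
  by rewrite !mxE.
by apply: eq_bigr => k _; rewrite !mxE.
Qed.

Lemma minor_herm : (f *m X *m f ^t*) ^t* = f *m X *m f ^t*.
Proof. by rewrite !trCmul trmxCK hX mulmxA. Qed.

Lemma minor_shift : f *m M *m f ^t* = f *m X *m f ^t* - z%:M.
Proof. by rewrite mulmxBr mulmxBl mul_mx_scalar -scalemxAl hevecK scalemx1. Qed.

Lemma cross_row : e *m M *m f ^t* = r.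
Proof.
by rewrite mulmxBr mulmxBl mul_mx_scalar -scalemxAl evec_hevec scaler0 subr0.
Qed.

Lemma cross_col : f *m M *m e ^t* = r ^t*.
Proof.
rewrite mulmxBr mulmxBl mul_mx_scalar -scalemxAl hevec_evec scaler0 subr0.
by rewrite /r /offrow !trCmul trmxCK hX mulmxA.
Qed.

(** [X i i] is real and the imaginary part of the quadratic form in [S] is
    [eta |r S|^2], so the Schur complement lies below the real axis; this is
    what makes it invertible. *)
Lemma Im_schur_denom :
  complex.Im d = - complex.Im z * (1 + rowsq (r *m S)).
Proof.
have hXii : complex.Im (X i i) = 0.
  have /matrixP/(_ i i) := hX; rewrite 2!mxE => /(congr1 (@complex.Im R)).
  case: (X i i) => a b /=; lra.
rewrite /d /schur_denom !ImB hXii Im_quad//; last exact: minor_herm.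
by lra.
Qed.

Lemma schur_denom_neq0 : d != 0.
Proof.
apply/eqP => d0; have := Im_schur_denom; rewrite d0 /=.
have := rowsq_ge0 (r *m S); have := hz; nra.
Qed.

Let v := e ^t* - f ^t* *m S *m r ^t*.
Let w := e - r *m S *m f.

(** The block inversion formula, with the [i]-th row and column kept in
    place by means of [e] and [f]: applying [X - z] to the column [v] gives
    [d e^*], and applying it to [f^* S f] gives the identity up to a multiple
    of [e^*]. *)
Lemma schur_inverse : resolvent X z = f ^t* *m S *m f + d^-1 *: (v *m w).
Proof.
have A1 : f *m M *m f ^t* *m S = 1%:M.
  by rewrite minor_shift; apply: shiftV => //; exact: minor_herm.
have fMv : f *m (M *m v) = 0.
  by rewrite mulmxA mulmxBr cross_col !mulmxA A1 mul1mx subrr.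
have eMe : e *m M *m e ^t* = (X i i - z)%:M.
  rewrite evec_full full_evec; apply/matrixP => a b.
  by rewrite !ord1 !mxE eqxx.
have eMv : e *m (M *m v) = d%:M.
  rewrite mulmxA mulmxBr !mulmxA cross_row eMe.
  by rewrite [r *m _ *m _]mx11_scalar -raddfB.
have Mv : M *m v = d *: e ^t*.
  rewrite -[M *m v]mul1mx -evec_split mulmxDl -!mulmxA fMv eMv mulmx0 addr0.
  by rewrite mul_mx_scalar.
have MfSf : M *m (f ^t* *m S *m f) = f ^t* *m f + e ^t* *m (r *m S *m f).
  rewrite -[M in LHS]mul1mx -evec_split mulmxDl mulmxDl addrC; congr (_ + _).
    rewrite !mulmxA -(mulmxA (f ^t*)) -(mulmxA (f ^t*)) -(mulmxA (f ^t*)).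
    by rewrite A1 mulmx1.
  by rewrite -cross_row !mulmxA.
have h : M *m (f ^t* *m S *m f + d^-1 *: (v *m w)) = 1%:M.
  rewrite mulmxDr MfSf -scalemxAr [M *m (v *m w)]mulmxA Mv -scalemxAl scalerA.
  rewrite mulVf ?schur_denom_neq0//.
  by rewrite scale1r mulmxBr addrACA subrr addr0 addrC evec_split.
rewrite /resolvent -[LHS]mulmx1 -h mulmxA mulVmx ?mul1mx//.
exact: shift_unit.
Qed.

Lemma resolvent_ii : resolvent X z i i = d^-1.
Proof.
have -> : resolvent X z i i = (e *m resolvent X z *m e ^t*) 0 0.
  by rewrite evec_full full_evec !mxE.
rewrite schur_inverse mulmxDr mulmxDl !mulmxA evec_hevec !mul0mx add0r.
rewrite -scalemxAr -scalemxAl.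
have -> : e *m (v *m w) *m e ^t* = 1%:M.
  have -> : e *m (v *m w) *m e ^t* = (e *m v) *m (w *m e ^t*) by rewrite !mulmxA.
  have -> : e *m v = 1%:M.
    by rewrite mulmxBr evecK !mulmxA evec_hevec !mul0mx subr0.
  rewrite mul1mx mulmxBl evecK -[_ *m e ^t*]mulmxA.
  by rewrite hevec_evec mulmx0 subr0.
by rewrite !mxE eqxx mulr1.
Qed.

Lemma diagGE : diagG X z i = d^-1.
Proof. by rewrite -resolvent_ii /diagG evec_full full_evec !mxE. Qed.

Lemma trace_diff :
  \tr (resolvent X z) - \tr S = d^-1 * (1 + (r *m S *m S *m r ^t*) 0 0).
Proof.
rewrite schur_inverse raddfD /= mxtrace_mulC mulmxA hevecK mul1mx addrAC subrr add0r.
rewrite mxtraceZ mxtrace_mulC; congr (_ * _).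
have -> : w *m v = 1%:M + r *m S *m S *m r ^t*.
  have ev : e *m v = 1%:M.
    by rewrite mulmxBr evecK !mulmxA evec_hevec !mul0mx subr0.
  rewrite {1}/w mulmxBl ev; congr (_ + _).
  rewrite -[_ *m v]mulmxA mulmxBr hevec_evec sub0r.
  by rewrite !mulmxA hevecK mul1mx mulmxN opprK !mulmxA.
by rewrite raddfD /= !trace_mx11 !mxE eqxx.
Qed.

(** The numerator in [trace_diff] is at most [1 + |r S|^2], which is
    [- Im d / eta], hence at most [|d| / eta]. *)
Lemma trace_diff_le : cabs (\tr (resolvent X z) - \tr S) <= (complex.Im z)^-1.
Proof.
rewrite trace_diff Normc.normcM Normc.normcV.
have d0 : 0 < cabs d by rewrite cabs_gt0 schur_denom_neq0.
rewrite ler_pdivrMl// ler_pdivlMr//.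
have h1 : cabs (1 + (r *m S *m S *m r ^t*) 0 0) <= 1 + rowsq (r *m S).
  apply: (le_trans (cabsD _ _)); rewrite Normc.normc1 lerD2l.
  by apply: quad2_le => //; exact: minor_herm.
have h2 := Im_le_cabs d; rewrite Im_schur_denom normrM normrN in h2.
apply: le_trans h2; rewrite mulrC !ger0_norm ?(ltW hz) ?addr_ge0 ?rowsq_ge0//.
by rewrite ler_pM2l.
Qed.

Lemma QerrE : Qerr X z i = (r *m S *m r ^t*) 0 0 - X i i - hatG X z i.
Proof.
rewrite /Qerr; congr (_ - _ - _); congr fun_of_matrix.
by rewrite {2}/r /offrow !trCmul trmxCK hX !mulmxA.
Qed.

Lemma schur_denomE : d = - (z + hatG X z i + Qerr X z i).
Proof. by rewrite QerrE /d /schur_denom -/r -/S; ring. Qed.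

End Schur.

(** * Evaluation of the semicircle integral *)

Section Antiderivative.
Variable R : realType.
Implicit Types (t : R) (A B : R -> R).

Lemma is_derive_lnmod A B t dA dB : is_derive t 1 A dA -> is_derive t 1 B dB ->
  0 < A t ->
  is_derive t 1 (fun x => ln (A x ^+ 2 + B x ^+ 2) / 2)
    ((A t * dA + B t * dB) / (A t ^+ 2 + B t ^+ 2)).
Proof.
move=> hA hB A0.
have n0 : 0 < A t ^+ 2 + B t ^+ 2 by rewrite ltr_wpDr ?sqr_ge0// exprn_gt0.
have h1 : is_derive t 1 (fun x => A x ^+ 2 + B x ^+ 2) (2 * (A t * dA + B t * dB)).
  apply: is_derive_eq; rewrite /GRing.scale /=; ring.
have h2 := is_derive1_ln n0.
have h3 := @is_derive1_comp _ _ (fun x => A x ^+ 2 + B x ^+ 2) t _ _ h2 h1.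
apply: is_derive_eq; rewrite /GRing.scale /=; field.
by rewrite gt_eqF.
Qed.

Lemma is_derive_arg A B t dA dB : is_derive t 1 A dA -> is_derive t 1 B dB ->
  0 < A t ->
  is_derive t 1 (fun x => atan (B x / A x))
    ((A t * dB - B t * dA) / (A t ^+ 2 + B t ^+ 2)).
Proof.
move=> hA hB A0.
have A1 : A t != 0 by rewrite gt_eqF.
have n0 : 0 < A t ^+ 2 + B t ^+ 2 by rewrite ltr_wpDr ?sqr_ge0// exprn_gt0.
have h0 := @is_deriveV R A t dA 1 A1 hA.
have h1 : is_derive t 1 (fun x => B x / A x) ((A t * dB - B t * dA) / A t ^+ 2).
  apply: is_derive_eq; rewrite /GRing.scale /=; field.
  by rewrite gt_eqF.
have h2 := is_derive1_atan (B t / A t).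
have h3 := @is_derive1_comp _ _ (fun x => B x / A x) t _ _ h2 h1.
apply: is_derive_eq; rewrite /GRing.scale /=; field.
by rewrite A1 gt_eqF //= addrC.
Qed.

Lemma is_derive_sqrtc A t dA : is_derive t 1 A dA -> 0 < A t ->
  is_derive t 1 (fun x => Num.sqrt (A x)) (dA / (2 * Num.sqrt (A t))).
Proof.
move=> hA A0.
have h2 := is_derive1_sqrt A0.
have h3 := @is_derive1_comp _ _ A t _ _ h2 hA.
by apply: is_derive_eq; rewrite /GRing.scale /= mulrC.
Qed.

Section PointwiseContinuity.
Implicit Types (f g : R -> R).

Lemma contD f g t : {for t, continuous f} -> {for t, continuous g} ->
  {for t, continuous (fun x => f x + g x)}.
Proof. exact: continuousD. Qed.

Lemma contB f g t : {for t, continuous f} -> {for t, continuous g} ->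
  {for t, continuous (fun x => f x - g x)}.
Proof. exact: continuousB. Qed.

Lemma contM f g t : {for t, continuous f} -> {for t, continuous g} ->
  {for t, continuous (fun x => f x * g x)}.
Proof. exact: continuousM. Qed.

Lemma contX f n t : {for t, continuous f} ->
  {for t, continuous (fun x => f x ^+ n)}.
Proof. by move=> cf; exact: (continuous_comp cf (@exprn_continuous _ n _)). Qed.

Lemma contV f t : f t != 0 -> {for t, continuous f} ->
  {for t, continuous (fun x => (f x)^-1)}.
Proof. exact: continuousV. Qed.

Lemma contsqrt f t : {for t, continuous f} ->
  {for t, continuous (fun x => Num.sqrt (f x))}.
Proof. by move=> cf; exact: (continuous_comp cf (@sqrt_continuous _ _)). Qed.

Lemma cont_cst (c t : R) : {for t, continuous (fun _ : R => c)}.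
Proof. exact: cst_continuous. Qed.

Lemma cont_id t : {for t, continuous (fun x : R => x)}.
Proof. exact: cvg_id. Qed.

End PointwiseContinuity.

(** The angle [phi] between [0] and [pi] with [t = 2 cos phi].  The formula
    for [tan (phi / 4)] is used rather than the arc cosine because it is
    continuous at both edges. *)
Definition sangle t : R := 4 * atan (Num.sqrt (2 - t) / (2 + Num.sqrt (2 + t))).
(** [2 sin phi] for the angle above. *)
Definition ssin t : R := Num.sqrt (4 - t ^+ 2).

Lemma ssinE t : -2 <= t <= 2 -> ssin t = Num.sqrt (2 - t) * Num.sqrt (2 + t).
Proof.
move=> h; rewrite -sqrtrM; last lra.
by rewrite /ssin; congr Num.sqrt; ring.
Qed.

Lemma ssin_gt0 t : -2 < t < 2 -> 0 < ssin t.
Proof. by move=> h; rewrite sqrtr_gt0; nra. Qed.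

Lemma ssin_sqr t : -2 <= t <= 2 -> ssin t ^+ 2 = 4 - t ^+ 2.
Proof. by move=> h; rewrite sqr_sqrtr//; nra. Qed.

Lemma is_derive_ssin t : -2 < t < 2 -> is_derive t 1 ssin (- t / ssin t).
Proof.
move=> h; have p : 0 < 4 - t ^+ 2 by nra.
have h1 : is_derive t 1 (fun x => 4 - x ^+ 2) (- (2 * t)).
  by apply: is_derive_eq; rewrite /GRing.scale /=; ring.
apply: (is_derive_eq (is_derive_sqrtc h1 p)).
rewrite -/(ssin t); field.
by rewrite gt_eqF// sqrtr_gt0.
Qed.

Lemma is_derive_sangle t : -2 < t < 2 -> is_derive t 1 sangle (- (ssin t)^-1).
Proof.
move=> h.
have p1 : 0 < 2 - t by lra.
have p2 : 0 < 2 + t by lra.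
have h1 : is_derive t 1 (fun x => 2 - x) (- 1 : R).
  by apply: is_derive_eq; rewrite ?/GRing.scale /=; ring.
have h2 : is_derive t 1 (fun x => 2 + x) (1 : R).
  by apply: is_derive_eq; rewrite ?/GRing.scale /=; ring.
have h3 := is_derive_sqrtc h1 p1.
have h4 := is_derive_sqrtc h2 p2.
have h5 : is_derive t 1 (fun x => 2 + Num.sqrt (2 + x)) (1 / (2 * Num.sqrt (2 + t))).
  by apply: is_derive_eq; rewrite ?/GRing.scale /=; ring.
have p5 : 0 < 2 + Num.sqrt (2 + t) by rewrite ltr_wpDr ?sqrtr_ge0.
have h6 := is_derive_arg h5 h3 p5.
apply: is_derive_eq; rewrite /GRing.scale /= ssinE; last lra.
have a0 : 0 < Num.sqrt (2 - t) by rewrite sqrtr_gt0.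
have b0 : 0 < Num.sqrt (2 + t) by rewrite sqrtr_gt0.
have e : Num.sqrt (2 - t) ^+ 2 = 4 - Num.sqrt (2 + t) ^+ 2.
  by rewrite !sqr_sqrtr; [ring|lra|lra].
move: (Num.sqrt (2 - t)) (Num.sqrt (2 + t)) a0 b0 e => a b a0 b0 e.
have -> : (2 + b) * (- 1 / (2 * a)) - a * (1 / (2 * b)) =
    - ((2 + b) * b + a ^+ 2) / (2 * a * b).
  by field; rewrite !gt_eqF.
rewrite e; field; rewrite !gt_eqF //=; nra.
Qed.

Section Primitive.
Variable m : R[i].
Let p := complex.Re m.
Let q := complex.Im m.
Hypothesis m1 : cabs m < 1.

(** For [|m| < 1] and [t = 2 cos phi], the points [1 + m exp (i phi)] and
    [1 + m exp (- i phi)], obtained for [e = 1] and [e = - 1], lie in the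
    right half-plane, where the logarithm is half the logarithm of the squared
    modulus plus [i] times the arc tangent of a quotient. *)
Definition argRe (e : R) t : R := 1 + (p * t - e * q * ssin t) / 2.
Definition argIm (e : R) t : R := (q * t + e * p * ssin t) / 2.

Lemma argRe_gt0 e t : e ^+ 2 = 1 -> -2 <= t <= 2 -> 0 < argRe e t.
Proof.
move=> e1 ht; have hs : ssin t ^+ 2 = 4 - t ^+ 2 by rewrite /ssin sqr_sqrtr//; nra.
have : p ^+ 2 + q ^+ 2 < 1.
  by rewrite -cabs_sqr -[ltRHS](expr1n _ 2%N) ltr_pXn2r ?nnegrE ?cabs_ge0.
(* Lagrange's identity bounds the real part of [m exp (i phi)] by [|m|]. *)
have : (p * t - e * q * ssin t) ^+ 2 + (e * q * t + p * ssin t) ^+ 2 =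
       (p ^+ 2 + e ^+ 2 * q ^+ 2) * (t ^+ 2 + ssin t ^+ 2) by ring.
rewrite e1 hs /argRe; set x := p * t - _; set y := e * q * t + _.
have := sqr_ge0 y; nra.
Qed.

Lemma is_derive_argRe e t : -2 < t < 2 ->
  is_derive t 1 (argRe e) ((p + e * q * (t / ssin t)) / 2).
Proof.
move=> h; have h1 := is_derive_ssin h.
by apply: is_derive_eq; rewrite ?/GRing.scale /=; ring.
Qed.

Lemma is_derive_argIm e t : -2 < t < 2 ->
  is_derive t 1 (argIm e) ((q - e * p * (t / ssin t)) / 2).
Proof.
move=> h; have h1 := is_derive_ssin h.
by apply: is_derive_eq; rewrite ?/GRing.scale /=; ring.
Qed.

Definition lnmod e t : R := ln (argRe e t ^+ 2 + argIm e t ^+ 2) / 2.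
Definition argu e t : R := atan (argIm e t / argRe e t).

(** The antiderivative of [ssin t / (t - z)], for [z = - (m + m^-1)], is
    [2 sin phi - 2 m phi
     + i (m^-1 - m) (log (1 + m exp (i phi)) - log (1 + m exp (- i phi)))].
    Its real and imaginary parts are both real combinations of the
    four functions below. *)
Definition primitive (a b c d : R) t : R :=
  a * ssin t + b * sangle t + c * (lnmod 1 t - lnmod (-1) t)
  + d * (argu 1 t - argu (-1) t).

Lemma ssin_cont t : {for t, continuous ssin}.
Proof.
by apply: contsqrt; apply: contB; [exact: cont_cst|apply: contX; exact: cont_id].
Qed.

Lemma sangle_cont t : {for t, continuous sangle}.
Proof.
apply: contM; first exact: cont_cst.
apply: (continuous_comp (f := fun t => Num.sqrt (2 - t) / (2 + Num.sqrt (2 + t))));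
  last exact: continuous_atan.
apply: contM.
  by apply: contsqrt; apply: contB; [exact: cont_cst|exact: cont_id].
apply: contV; first by rewrite gt_eqF// ltr_wpDr ?sqrtr_ge0.
apply: contD; first exact: cont_cst.
by apply: contsqrt; apply: contD; [exact: cont_cst|exact: cont_id].
Qed.

Lemma argRe_cont e t : {for t, continuous (argRe e)}.
Proof.
apply: contD; first exact: cont_cst.
apply: contM; last exact: cont_cst.
apply: contB; apply: contM; try exact: cont_cst; first exact: cont_id.
exact: ssin_cont.
Qed.

Lemma argIm_cont e t : {for t, continuous (argIm e)}.
Proof.
apply: contM; last exact: cont_cst.
apply: contD; apply: contM; try exact: cont_cst; first exact: cont_id.
exact: ssin_cont.
Qed.

Lemma lnmod_cont e t : e ^+ 2 = 1 -> -2 <= t <= 2 -> {for t, continuous (lnmod e)}.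
Proof.
move=> e1 ht; have h0 := argRe_gt0 e1 ht.
apply: contM; last exact: cont_cst.
apply: (continuous_comp (f := fun t => argRe e t ^+ 2 + argIm e t ^+ 2)).
  apply: contD; apply: contX; [exact: argRe_cont|exact: argIm_cont].
by apply: continuous_ln; rewrite ltr_wpDr ?sqr_ge0// exprn_gt0.
Qed.

Lemma argu_cont e t : e ^+ 2 = 1 -> -2 <= t <= 2 -> {for t, continuous (argu e)}.
Proof.
move=> e1 ht; have h0 := argRe_gt0 e1 ht.
apply: (continuous_comp (f := fun t => argIm e t / argRe e t));
  last exact: continuous_atan.
apply: contM; first exact: argIm_cont.
by apply: contV; [rewrite gt_eqF|exact: argRe_cont].
Qed.

Lemma primitive_cont a b c d t : -2 <= t <= 2 ->
  {for t, continuous (primitive a b c d)}.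
Proof.
move=> ht; have e1 : (1 : R) ^+ 2 = 1 by rewrite expr1n.
have e2 : (- 1 : R) ^+ 2 = 1 by rewrite sqrrN expr1n.
apply: contD; first apply: contD; first apply: contD.
- by apply: contM; [exact: cont_cst|exact: ssin_cont].
- by apply: contM; [exact: cont_cst|exact: sangle_cont].
- apply: contM; first exact: cont_cst.
  by apply: contB; exact: lnmod_cont.
- apply: contM; first exact: cont_cst.
  by apply: contB; exact: argu_cont.
Qed.

(** At both edges [sin phi] vanishes and the two logarithms cancel, so that
    only the angle contributes. *)
Lemma primitive2 a b c d : primitive a b c d 2 = 0.
Proof.
have s0 : ssin 2 = 0 by rewrite /ssin (_ : 4 - _ = 0) ?sqrtr0//; ring.
rewrite /primitive /lnmod /argu /argRe /argIm s0 /sangle !mulr0 !addr0 !subr0 !subrr.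
by rewrite sqrtr0 mul0r atan0 !mulr0 !addr0.
Qed.

Lemma primitiveN2 a b c d : primitive a b c d (-2) = b * pi.
Proof.
have s0 : ssin (-2) = 0 by rewrite /ssin (_ : 4 - _ = 0) ?sqrtr0//; ring.
rewrite /primitive /lnmod /argu /argRe /argIm s0 /sangle !mulr0 !addr0 !subr0 !subrr.
rewrite sqrtr0 addr0 opprK !mulr0 !addr0 add0r.
have -> : Num.sqrt (2 + 2) = 2 :> R.
  by rewrite (_ : 2 + 2 = 2 ^+ 2) ?sqrtr_sqr ?ger0_norm//; ring.
by rewrite divff// atan1; congr (_ * _); field.
Qed.

End Primitive.
End Antiderivative.

Section SemicircleIntegral.
Variable R : realType.
Implicit Types (t : R) (m z : R[i]).

(** The derivative of [primitive], as an identity between complex numbers.  It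
    rests on [W 1 * W (-1) = m (t - z)], the factorisation of [t - z] that
    suggests the substitution [z = - (m + m^-1)]. *)
Lemma primitive_identity (i m z s t : R[i]) : i ^+ 2 = - 1 -> m != 0 -> s != 0 ->
  t - z != 0 -> z = - (m + m^-1) -> s ^+ 2 = 4 - t ^+ 2 ->
  let W e := 1 + m * (t + e * i * s) / 2 in
  let D e := m * (1 - e * i * (t / s)) / 2 in
  W 1 != 0 -> W (-1) != 0 ->
  - (t / s) + 2 * m / s + i * (m^-1 - m) * (D 1 / W 1 - D (-1) / W (-1))
  = s / (t - z).
Proof.
move=> i2 m0 s0 tz hz s2 W D W1 W2.
have two : (2 : R[i]) != 0 by rewrite pnatr_eq0.
have e1 : D 1 / W 1 - D (-1) / W (-1) = (D 1 * W (-1) - D (-1) * W 1) / (W 1 * W (-1)).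
  by field; rewrite W1 W2.
have e2 : W 1 * W (-1) = m * (t - z).
  have -> : W 1 * W (-1) = 1 + m * t + m ^+ 2 * (t ^+ 2 - i ^+ 2 * s ^+ 2) / 4.
    by rewrite /W; field.
  rewrite i2 s2 hz; field; by rewrite m0.
have e3 : D 1 * W (-1) - D (-1) * W 1 = - i * m * (t + 2 * m) / s.
  have -> : D 1 * W (-1) - D (-1) * W 1
     = - i * m * (t / s + m / 2 * (s ^+ 2 + t ^+ 2) / s).
    by rewrite /W /D; field.
  by rewrite s2; field.
rewrite e1 e2 e3.
have -> : - (t / s) + 2 * m / s
    + i * (m^-1 - m) * (- i * m * (t + 2 * m) / s / (m * (t - z)))
  = ((2 * m - t) * (t - z) - i ^+ 2 * (m^-1 - m) * (t + 2 * m)) / (s * (t - z)).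
  by field; rewrite m0 s0 tz.
have -> : s / (t - z) = s ^+ 2 / (s * (t - z)) by field; rewrite s0 tz.
congr (_ / _); rewrite i2 s2 hz; field.
by rewrite m0.
Qed.

Section Fixed.
Variables m z : R[i].
Hypotheses (m0 : m != 0) (m1 : cabs m < 1) (hz : z = - (m + m^-1))
  (z0 : 0 < complex.Im z).
Let p := complex.Re m.
Let q := complex.Im m.

(** The derivative of the logarithm of [1 + m exp (i e phi)] in [t]. *)
Definition logder e t : R[i] :=
  (((p + e * q * (t / ssin t)) / 2) +i* ((q - e * p * (t / ssin t)) / 2)) /
  (argRe m e t +i* argIm m e t).

Lemma logderE e t : e ^+ 2 = 1 -> -2 <= t <= 2 ->
  let n := argRe m e t ^+ 2 + argIm m e t ^+ 2 in
  logder e t =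
  ((argRe m e t * ((p + e * q * (t / ssin t)) / 2)
     + argIm m e t * ((q - e * p * (t / ssin t)) / 2)) / n) +i*
  ((argRe m e t * ((q - e * p * (t / ssin t)) / 2)
     - argIm m e t * ((p + e * q * (t / ssin t)) / 2)) / n).
Proof.
move=> e1 ht n; have h := argRe_gt0 m1 e1 ht.
have n0 : n != 0 by rewrite gt_eqF// ltr_wpDr ?sqr_ge0// exprn_gt0.
rewrite /logder; apply: (mulIf (x := argRe m e t +i* argIm m e t)).
  by rewrite eq_complex /= gt_eqF.
rewrite divfK; last by rewrite eq_complex /= gt_eqF.
rewrite /n in n0 *; set A := argRe _ _ _ in n0 *; set B := argIm _ _ _ in n0 *.
set u := _ / 2; set v := _ / 2.
by apply/eqP; rewrite eq_complex /=; apply/andP; split; apply/eqP; field.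
Qed.

Lemma is_derive_primitive a b c d t : -2 < t < 2 ->
  is_derive t 1 (primitive m a b c d)
    (a * (- t / ssin t) - b / ssin t
     + c * complex.Re (logder 1 t - logder (-1) t)
     + d * complex.Im (logder 1 t - logder (-1) t)).
Proof.
move=> ht; have ht' : -2 <= t <= 2 by lra.
have e1 : (1 : R) ^+ 2 = 1 by rewrite expr1n.
have e2 : (- 1 : R) ^+ 2 = 1 by rewrite sqrrN expr1n.
have d1 := is_derive_ssin ht; have d2 := is_derive_sangle ht.
have p1 := argRe_gt0 m1 e1 ht'; have p2 := argRe_gt0 m1 e2 ht'.
have a1 := is_derive_argRe m 1 ht; have a2 := is_derive_argRe m (-1) ht.
have b1 := is_derive_argIm m 1 ht; have b2 := is_derive_argIm m (-1) ht.
have d3 := is_derive_lnmod a1 b1 p1; have d4 := is_derive_lnmod a2 b2 p2.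
have d5 := is_derive_arg a1 b1 p1; have d6 := is_derive_arg a2 b2 p2.
rewrite ReB ImB !logderE//.
rewrite {p1 p2 a1 a2 b1 b2} -/(lnmod m 1) -/(lnmod m (-1)) in d3 d4 d5 d6.
rewrite -/(argu m 1) -/(argu m (-1)) in d5 d6.
rewrite /primitive; apply: is_derive_eq; rewrite /GRing.scale /= /p /q; ring.
Qed.

Let kap := m^-1 - m.

Lemma integrandE t : -2 < t < 2 ->
  (ssin t)%:C / (t%:C - z) =
  (- (t / ssin t))%:C + 2 * m / (ssin t)%:C + 'i * kap * (logder 1 t - logder (-1) t).
Proof.
move=> ht.
have s0 := ssin_gt0 ht.
have ht' : -2 <= t <= 2 by lra.
have s2 := ssin_sqr ht'.
have e1 : (1 : R) ^+ 2 = 1 by rewrite expr1n.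
have e2 : (- 1 : R) ^+ 2 = 1 by rewrite sqrrN expr1n.
have sC : (ssin t)%:C != 0 :> R[i] by rewrite eq_complex /= gt_eqF.
have tz : t%:C - z != 0.
  apply/eqP => /(congr1 (@complex.Im R)); rewrite ImB /= sub0r => /eqP.
  by rewrite oppr_eq0 gt_eqF.
have i2 : 'i ^+ 2 = - 1 :> R[i] by rewrite sqr_i.
have s2C : (ssin t)%:C ^+ 2 = 4 - t%:C ^+ 2 :> R[i].
  by rewrite -!rmorphXn s2 rmorphB /= rmorph_nat.
have C2 (x : R) : (x / 2)%:C = x%:C / 2 :> R[i].
  by rewrite fmorph_div /= rmorph_nat.
have mE : m = p%:C + 'i * q%:C by exact: complexE.
have cE (x y : R) : x +i* y = x%:C + 'i * y%:C by exact: complexE.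
have WE e : argRe m e t +i* argIm m e t = 1 + m * (t%:C + e%:C * 'i * (ssin t)%:C) / 2.
  rewrite cE /argRe /argIm -/p -/q mE !(rmorphD, rmorphB, C2, rmorphM) /= rmorph1.
  set I := 'i in i2 *. 
  have -> : (p%:C + I * q%:C) * (t%:C + e%:C * I * (ssin t)%:C) =
     (p%:C * t%:C + I ^+ 2 * e%:C * q%:C * (ssin t)%:C) +
     I * (q%:C * t%:C + e%:C * p%:C * (ssin t)%:C) by ring.
  by rewrite i2; field.
have DE e : ((p + e * q * (t / ssin t)) / 2) +i* ((q - e * p * (t / ssin t)) / 2)
   = m * (1 - e%:C * 'i * (t%:C / (ssin t)%:C)) / 2.
  rewrite -fmorph_div; move: (t / ssin t) => w0.
  rewrite cE mE !C2 !(rmorphD, rmorphN, rmorphM) /=.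
  set I := 'i in i2 *; set w := w0%:C.
  have -> : (p%:C + I * q%:C) * (1 - e%:C * I * w) =
     (p%:C - I ^+ 2 * e%:C * q%:C * w) + I * (q%:C - e%:C * p%:C * w) by ring.
  by rewrite i2; field.
have W0 e : e ^+ 2 = 1 -> argRe m e t +i* argIm m e t != 0.
  by move=> e3; rewrite eq_complex /= gt_eqF//; apply: argRe_gt0.
have C1 : (1 : R)%:C = 1 :> R[i] by [].
have CN1 : (- 1 : R)%:C = - 1 :> R[i] by rewrite rmorphN.
have := W0 _ e1; have := W0 _ e2; rewrite /logder !WE !DE CN1 C1 => w2 w1.
by rewrite -(@primitive_identity 'i m z (ssin t)%:C t%:C)// rmorphN fmorph_div.
Qed.

Lemma semicircle_integral (g : R -> R) (a b c d : R) :
  (forall t, -2 < t < 2 -> g t = a * (- t / ssin t) - b / ssin t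
     + c * complex.Re (logder 1 t - logder (-1) t)
     + d * complex.Im (logder 1 t - logder (-1) t)) ->
  continuous g ->
  (\int[@lebesgue_measure R]_(t in `[(-2 : R), 2]) g t)%R = - b * pi.
Proof.
move=> hg cg; rewrite /Rintegral.
rewrite (@continuous_FTC2 R g (primitive m a b c d))//.
- by rewrite primitive2 primitiveN2 -EFinB /= sub0r mulNr.
- lra.
- by apply: continuous_subspaceT.
- split.
  + move=> t; rewrite in_itv /= => ht.
    by have [] := is_derive_primitive a b c d ht.
  + apply: cvg_at_right_filter; apply: primitive_cont => //; lra.
  + apply: cvg_at_left_filter; apply: primitive_cont => //; lra.
- move=> t; rewrite in_itv /= => ht.
  by rewrite derive1E hg//; apply: derive_val; exact: is_derive_primitive.
Qed.

Lemma integrand_parts t : (ssin t)%:C / (t%:C - z) =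
  (ssin t * (t - complex.Re z) / ((t - complex.Re z) ^+ 2 + complex.Im z ^+ 2)) +i*
  (ssin t * complex.Im z / ((t - complex.Re z) ^+ 2 + complex.Im z ^+ 2)).
Proof.
have n0 : (t - complex.Re z) ^+ 2 + complex.Im z ^+ 2 != 0.
  by rewrite gt_eqF// ltr_wpDl ?sqr_ge0// exprn_gt0.
have tz : t%:C - z != 0.
  apply/eqP => /(congr1 (@complex.Im R)); rewrite ImB /= sub0r => /eqP.
  by rewrite oppr_eq0 gt_eqF.
apply: (mulIf tz); rewrite divfK//.
move: n0; case: z => x y /= n0.
by apply/eqP; rewrite eq_complex /=; apply/andP; split; apply/eqP; field.
Qed.

Lemma semicircle_mE : semicircle_m z = m.
Proof.
have pi0 : (pi : R) != 0 by rewrite gt_eqF ?pi_gt0.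
have cden t : {for t, continuous (fun t =>
    ((t - complex.Re z) ^+ 2 + complex.Im z ^+ 2)^-1)}.
  apply: contV; first by rewrite gt_eqF// ltr_wpDl ?sqr_ge0// exprn_gt0.
  apply: contD; last exact: cont_cst.
  by apply: contX; apply: contB; [exact: cont_id|exact: cont_cst].
have cRe : continuous (fun t => complex.Re ((ssin t)%:C / (t%:C - z))).
  rewrite (_ : (fun _ => _) = (fun t => ssin t * (t - complex.Re z) *
      ((t - complex.Re z) ^+ 2 + complex.Im z ^+ 2)^-1)); last first.
    by apply/funext => t; rewrite integrand_parts.
  suff h t : {for t, continuous (fun t => ssin t * (t - complex.Re z) *
      ((t - complex.Re z) ^+ 2 + complex.Im z ^+ 2)^-1)} by exact: h.
  apply: contM; last exact: cden.
  apply: contM; first exact: ssin_cont.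
  by apply: contB; [exact: cont_id|exact: cont_cst].
have cIm : continuous (fun t => complex.Im ((ssin t)%:C / (t%:C - z))).
  rewrite (_ : (fun _ => _) = (fun t => ssin t * complex.Im z *
      ((t - complex.Re z) ^+ 2 + complex.Im z ^+ 2)^-1)); last first.
    by apply/funext => t; rewrite integrand_parts.
  suff h t : {for t, continuous (fun t => ssin t * complex.Im z *
      ((t - complex.Re z) ^+ 2 + complex.Im z ^+ 2)^-1)} by exact: h.
  apply: contM; last exact: cden.
  by apply: contM; [exact: ssin_cont|exact: cont_cst].
have s0 t : -2 < t < 2 -> ssin t != 0.
  by move=> ht; rewrite gt_eqF// ssin_gt0.
have hm : m = p +i* q by rewrite /p /q; case: (m).
rewrite /semicircle_m /Cintegral.
rewrite (@semicircle_integral _ 1 (- (2 * p))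
  (- complex.Im kap) (- complex.Re kap))//; last first.
  move=> t ht; rewrite integrandE// [LHS]ReD [X in X + _ = _]ReD.
  have -> : 2 * m / (ssin t)%:C = ((2 / ssin t)%:C * m).
    by rewrite fmorph_div /= rmorph_nat; ring.
  rewrite ReZ; case: (logder 1 t) => x y; case: (logder (-1) t) => x' y'.
  case: kap => k l /=.
  rewrite -/p. field; exact: s0.
rewrite (@semicircle_integral _ 0 (- (2 * q))
  (complex.Re kap) (- complex.Im kap))//; last first.
  move=> t ht; rewrite integrandE// [LHS]ImD [X in X + _ = _]ImD.
  have -> : 2 * m / (ssin t)%:C = ((2 / ssin t)%:C * m).
    by rewrite fmorph_div /= rmorph_nat; ring.
  rewrite ImZ; case: (logder 1 t) => x y; case: (logder (-1) t) => x' y'.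
  case: kap => k l /=.
  rewrite -/q; field; exact: s0.
rewrite [RHS]hm; move: (pi : R) pi0 => w w0; apply/eqP; rewrite eq_complex /=.
by apply/andP; split; apply/eqP; field.
Qed.

End Fixed.

(** The two roots of [m^2 + z m + 1] have product [1] and sum [- z], so exactly
    one of them is in the upper half-plane; comparing imaginary parts in
    [z = - (m + m^-1)] shows that it is inside the unit disc. *)
Lemma semicircle_spec z : 0 < complex.Im z ->
  [/\ semicircle_m z != 0, cabs (semicircle_m z) < 1,
      0 < complex.Im (semicircle_m z) &
      z = - (semicircle_m z + (semicircle_m z)^-1)].
Proof.
move=> z0.
suff [m [m0 m1 mi hz]] : exists m,
    [/\ m != 0, cabs m < 1, 0 < complex.Im m & z = - (m + m^-1)].
  by rewrite (semicircle_mE m0 m1 hz z0).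
pose s := sqrtC (z ^+ 2 - 4).
pose m1 := (- z + s) / 2; pose m2 := (- z - s) / 2.
have two : (2 : R[i]) != 0 by rewrite pnatr_eq0.
have four : (4 : R[i]) != 0 by rewrite pnatr_eq0.
have mm : m1 * m2 = 1.
  have -> : m1 * m2 = (z ^+ 2 - s ^+ 2) / 4 by rewrite /m1 /m2; field.
  by rewrite sqrtCK; field.
have ms : m1 + m2 = - z by rewrite /m1 /m2; field.
suff key (m m' : R[i]) : m * m' = 1 -> m + m' = - z -> 0 < complex.Im m ->
    exists m, [/\ m != 0, cabs m < 1, 0 < complex.Im m & z = - (m + m^-1)].
  have [h|h] := ltP 0 (complex.Im m1); first exact: (key m1 m2).
  apply: (key m2 m1); rewrite ?(mulrC m2) ?(addrC m2)//.
  have := congr1 (@complex.Im R) ms; rewrite ImD.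
  have : complex.Im (- z) = - complex.Im z by case: (z).
  have := congr1 (@complex.Im R) mm; have := congr1 (@complex.Re R) mm.
  case: m1 h {mm ms} => a b; case: m2 => c d /= b0 h1 h2 h3 h4.
  rewrite ltNge; apply/negP => d0.
  have ac : 1 <= a * c by have : 0 <= b * d; [rewrite mulr_le0|lra].
  have h5 : a ^+ 2 * d + b * (a * c) = 0.
    have -> : a ^+ 2 * d + b * (a * c) = a * (a * d + b * c) by ring.
    by rewrite h2 mulr0.
  have h6 : a ^+ 2 * d <= 0 by rewrite mulr_ge0_le0 ?sqr_ge0.
  have h7 : b * (a * c) <= b by nra.
  have a0 : 0 < a ^+ 2.
    rewrite exprn_even_gt0//=; apply/eqP => a0; by move: ac; rewrite a0 mul0r ler10.
  have b1 : b = 0 by lra.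
  have : a ^+ 2 * d = 0 by rewrite b1 mul0r addr0 in h5.
  move/eqP; rewrite mulf_eq0 gt_eqF//= => /eqP d1; lra.
move=> mm' ms' mi; exists m.
have m0 : m != 0 by apply/eqP => h; rewrite h ltxx in mi.
have mE : m^-1 = m' by rewrite -[LHS]mul1r -mm' mulrAC mulfV// mul1r.
split => //; last by rewrite mE ms' opprK.
have hn := cabs_sqr m; have n0 := cabs_ge0 m.
have : complex.Im m' * cabs m ^+ 2 = - complex.Im m.
  have := congr1 (@complex.Im R) mm'; have := congr1 (@complex.Re R) mm'.
  rewrite hn; case: (m) => a b; case: (m') => c d /= h1 h2.
  have -> : d * (a ^+ 2 + b ^+ 2) = a * (a * d + b * c) - b * (a * c - b * d) by ring.
  by rewrite h1 h2 mulr0 mulr1 sub0r.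
have := congr1 (@complex.Im R) ms'; rewrite ImD.
have -> : complex.Im (- z) = - complex.Im z by case: (z).
move=> h1 h2; rewrite ltNge; apply/negP => n1.
have : 1 <= cabs m ^+ 2 by rewrite expr_ge1.
nra.
Qed.

End SemicircleIntegral.

(** * Stability of the self-consistent equation *)

Section Stability.
Variable R : realType.

(** Here [w] plays the role of [sqrt h].  Averaging
    [(s + z) G_i + 1 = e_i / (z + s + e_i)] gives
    [(s - m) (s - m^-1) = N^-1 sum e_i / (z + s + e_i)]; the a priori bound on
    [s - m] keeps the denominators away from zero and [s] away from [m^-1],
    so that the equation controls [s - m].  The [G_i] are then compared
    with [m] one by one. *)
Lemma self_consistent_stability N (m z s : R[i]) (G e : 'I_N -> R[i]) (eps w : R) :
  (0 < N)%N -> m != 0 -> cabs m <= 1 -> z = - (m + m^-1) ->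
  0 < w <= 1 -> w <= cabs (m - m^-1) ->
  s = N%:R^-1 * \sum_i G i -> (forall i, G i = - (z + s + e i)^-1) ->
  (forall i, cabs (e i) <= eps) -> eps <= 1 / 8 -> cabs (s - m) <= w / 8 ->
  cabs (s - m) * w <= 2 * eps /\ forall i, cabs (G i - m) * w <= 4 * eps.
Proof.
move=> N0 m0 m1 hz w01 hw hs hG he eps8 weak.
have n0 : (N%:R : R[i]) != 0 by rewrite pnatr_eq0 -lt0n.
have nR : 0 < (N%:R : R) by rewrite ltr0n.
pose D i := z + s + e i.
have im1 : 1 <= cabs m^-1.
  by rewrite Normc.normcV invf_ge1// cabs_gt0.
have hD i : 3 / 4 <= cabs (D i).
  have : cabs m^-1 <= cabs (D i) + cabs (s - m) + cabs (e i).
    have -> : m^-1 = - D i + (s - m) + e i by rewrite /D hz; ring.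
    apply: (le_trans (cabsD _ _)); rewrite lerD2r.
    by apply: (le_trans (cabsD _ _)); rewrite cabsN.
  have := he i; lra.
have D0 i : D i != 0 by rewrite -cabs_gt0; have := hD i; lra.
have eps0 : 0 <= eps by apply: le_trans (he (Ordinal N0)); exact: cabs_ge0.
have quad : (s - m) * (s - m^-1) = N%:R^-1 * \sum_i e i / D i.
  have -> : (s - m) * (s - m^-1) = (s + z) * s + 1 by rewrite hz; field.
  have -> : \sum_i e i / D i = \sum_i ((s + z) * G i + 1).
    by apply: eq_bigr => i _; rewrite hG -/(D i) /D; field; exact: D0.
  rewrite big_split /= -mulr_sumr sumr_const card_ord [X in _ * X + 1]hs.
  by field.
have avg : cabs (N%:R^-1 * \sum_i e i / D i) <= 4 / 3 * eps.
  rewrite Normc.normcM Normc.normcV cabs_nat ler_pdivrMl//.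
  apply: (le_trans (cabs_sum _ _)).
  have -> : N%:R * (4 / 3 * eps) = \sum_(i < N) (4 / 3 * eps).
    by rewrite sumr_const card_ord [LHS]mulr_natl.
  apply: ler_sum => i _; rewrite Normc.normcM Normc.normcV ler_pdivrMr ?cabs_gt0//.
  have := he i; have := hD i; nra.
have low : 7 / 8 * w <= cabs (s - m^-1).
  have : cabs (m - m^-1) <= cabs (s - m) + cabs (s - m^-1).
    have -> : m - m^-1 = - (s - m) + (s - m^-1) by ring.
    by apply: (le_trans (cabsD _ _)); rewrite cabsN.
  lra.
have h1 : cabs (s - m) * w <= 2 * eps.
  have := avg; rewrite -quad Normc.normcM; have := cabs_ge0 (s - m); nra.
split=> // i.
have -> : G i - m = - (m * ((s - m) + e i)) / D i.
  rewrite hG -/(D i).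
  have -> : - (m * (s - m + e i)) = - (1 + m * D i) by rewrite /D hz; field.
  by field; exact: D0.
rewrite Normc.normcM Normc.normcV cabsN Normc.normcM mulrAC ler_pdivrMr ?cabs_gt0//.
have h2 : cabs m * cabs (s - m + e i) <= cabs (s - m) + cabs (e i).
  apply: le_trans (cabsD _ _); rewrite ler_piMl ?cabs_ge0//.
have h3 : cabs m * cabs (s - m + e i) * w <= 3 * eps.
  apply: (@le_trans _ _ ((cabs (s - m) + cabs (e i)) * w)).
    by rewrite ler_wpM2r//; lra.
  have := he i; have := cabs_ge0 (e i); nra.
have := hD i; nra.
Qed.

Lemma semicircle_sq (z : R[i]) (m := semicircle_m z) : 0 < complex.Im z ->
  (m - m^-1) ^+ 2 = (z - 2) * (z + 2).
Proof.
rewrite /m => z0; have [m0 _ _ hz] := semicircle_spec z0.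
by move: (semicircle_m z) m0 hz => {}m m0 ->; field.
Qed.

Lemma semicircle_eq (z : R[i]) (m := semicircle_m z) : 0 < complex.Im z ->
  m * (z + m) = - 1.
Proof.
rewrite /m => z0; have [m0 _ _ hz] := semicircle_spec z0.
by move: (semicircle_m z) m0 hz => {}m m0 ->; field.
Qed.

(** The edges are at distance [4], so the farther one is at distance at least
    [2] from [z]. *)
Lemma edge_h_le (z : R[i]) : edge_h z <= cabs (z - 2) * cabs (z + 2).
Proof.
rewrite /edge_h; set a := cabs (z + 2); set b := cabs (z - 2).
have a0 : 0 <= a := cabs_ge0 _; have b0 : 0 <= b := cabs_ge0 _.
have ab : 4 <= a + b.
  have <- : cabs ((z + 2) - (z - 2)) = 4.
    by rewrite (_ : z + 2 - (z - 2) = 4%:R) ?cabs_nat//; ring.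
  exact: cabsB.
rewrite !ge_min; apply/orP; right.
have [h|h] := lerP a b; apply/orP; [left|right]; nra.
Qed.

Lemma edge_h01 (z : R[i]) : 0 <= edge_h z <= 1.
Proof. by rewrite /edge_h !le_min !ge_min !cabs_ge0 ler01 lexx. Qed.

Lemma sqrt_edge_le (z : R[i]) (m := semicircle_m z) : 0 < complex.Im z ->
  Num.sqrt (edge_h z) <= cabs (m - m^-1).
Proof.
move=> z0; have /andP[h0 _] := edge_h01 z.
rewrite -(@ler_pXn2r _ 2%N)// ?nnegrE ?cabs_ge0 ?sqrtr_ge0// sqr_sqrtr//.
rewrite -[X in _ <= X]/(_ * _) -Normc.normcM -expr2 semicircle_sq//.
by rewrite Normc.normcM edge_h_le.
Qed.

(** Taking imaginary parts in [z |m|^2 = - (m |m|^2 + conj m)] gives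
    [eta |m|^2 = (1 - |m|^2) Im m <= (1 - |m|^2) |m|]. *)
Lemma semicircle_sq_le (z : R[i]) : 0 < complex.Im z ->
  cabs (semicircle_m z) ^+ 2 * (1 + complex.Im z) <= 1.
Proof.
move=> z0; have [m0 m1 mi hz] := semicircle_spec z0.
move: (semicircle_m z) m0 m1 mi hz => m m0 m1 mi hz.
have n0 : 0 < cabs m by rewrite cabs_gt0.
have : z * (cabs m ^+ 2)%:C = - (m * (cabs m ^+ 2)%:C + (m^* )%C).
  by rewrite {1}hz -mul_conj; field.
move/(congr1 (@complex.Im R)); rewrite [z * _]mulrC ImZ.
have -> r : complex.Im (- (m * r%:C + (m^* )%C)) = complex.Im m * (1 - r).
  by case: (m) => c d /=; ring.
have := le_trans (ler_norm _) (Im_le_cabs m).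
move: (cabs m) n0 m1 => n n0 n1; move: (complex.Im m) mi (complex.Im z) z0.
move=> b b0 y y0 bn e.
have n2 : 0 <= 1 - n ^+ 2 by nra.
have h1 : n * (n * y) <= n * (1 - n ^+ 2).
  by rewrite mulrA -expr2 e ler_wpM2r.
rewrite ler_pM2l// in h1; nra.
Qed.

(** Subtracting the equations [m (z + m) = - 1] for [z] and [z'] gives
    [(m - m') (1 - m m') = m m' (z - z')], and [|m m'| <= (1 + eta)^-1]. *)
Lemma semicircle_lipschitz (z z' : R[i]) (eta : R) : 0 < eta ->
  eta <= complex.Im z -> eta <= complex.Im z' ->
  cabs (semicircle_m z - semicircle_m z') <= eta^-1 * cabs (z - z').
Proof.
move=> eta0 hz hz'.
have z0 := lt_le_trans eta0 hz; have z0' := lt_le_trans eta0 hz'.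
have e := semicircle_eq z0; have e' := semicircle_eq z0'.
have b := semicircle_sq_le z0; have b' := semicircle_sq_le z0'.
move: (semicircle_m z) (semicircle_m z') e e' b b' => m m' e e' b b'.
have key : (m - m') * (1 - m * m') = m * m' * (z - z').
  have -> : (m - m') * (1 - m * m') = m * m' * (z - z') + m' * (- 1 - m * (z + m))
     - m * (- 1 - m' * (z' + m')) by ring.
  by rewrite e e' subrr !mulr0 addr0 subr0.
have := congr1 (@cabs R) key; rewrite !Normc.normcM => {}key.
have low : 1 - cabs m * cabs m' <= cabs (1 - m * m').
  have := cabsD (1 - m * m') (m * m'); rewrite subrK Normc.normc1 Normc.normcM; lra.
have n0 := cabs_ge0 m; have n0' := cabs_ge0 m'.
have d0 := cabs_ge0 (z - z'); have x0 := cabs_ge0 (m - m').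
move: (cabs m) (cabs m') n0 n0' b b' low key => n n' n0 n0' b b' low key.
move: (cabs (z - z')) (cabs (m - m')) (cabs (1 - m * m')) d0 x0 low key.
move=> d x c d0 x0 low key.
have p : n * n' * (1 + eta) <= 1.
  have : n ^+ 2 * (1 + eta) <= 1.
    by apply: le_trans b; rewrite ler_wpM2l ?sqr_ge0//; lra.
  have : n' ^+ 2 * (1 + eta) <= 1.
    by apply: le_trans b'; rewrite ler_wpM2l ?sqr_ge0//; lra.
  have := sqr_ge0 (n - n'); nra.
rewrite ler_pdivlMl//.
have np : 0 <= n * n' by rewrite mulr_ge0.
move: (n * n') np p low key => k k0 p low key.
have h1 : eta / (1 + eta) <= c.
  apply: le_trans low; rewrite ler_pdivrMr ?addr_gt0//; lra.
have h2 : k <= (1 + eta)^-1 by rewrite -[_^-1]mul1r ler_pdivlMr ?addr_gt0.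
have h3 : x * (eta / (1 + eta)) <= (1 + eta)^-1 * d.
  by apply: (@le_trans _ _ (x * c)); [rewrite ler_wpM2l|rewrite key ler_wpM2r].
have i0 : 0 < (1 + eta)^-1 by rewrite invr_gt0 addr_gt0.
by rewrite -(ler_pM2l i0) (_ : _ * (eta * x) = x * (eta / (1 + eta)))//; ring.
Qed.

End Stability.

(** * The error in the self-consistent equation *)

Section Stieltjes.
Variables (R : realType) (N : nat) (X : 'M[R[i]]_N).
Hypotheses (hN : (0 < N)%N) (hX : X ^t* = X).
Implicit Types z : R[i].

Definition stieltjes z : R[i] := N%:R^-1 * \tr (resolvent X z).

Let nR : 0 < (N%:R : R). Proof. by rewrite ltr0n. Qed.

Lemma cabs_avg_le (c : R) (F : 'I_N -> R[i]) : (forall i, cabs (F i) <= c) ->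
  cabs (N%:R^-1 * \sum_i F i) <= c.
Proof.
move=> hF; rewrite Normc.normcM Normc.normcV cabs_nat ler_pdivrMl//.
apply: (le_trans (cabs_sum _ _)).
have -> : N%:R * c = \sum_(i < N) c by rewrite sumr_const card_ord mulr_natl.
by apply: ler_sum => i _.
Qed.

Lemma stieltjes_le z : 0 < complex.Im z -> cabs (stieltjes z) <= (complex.Im z)^-1.
Proof. by move=> z0; apply: cabs_avg_le => i; exact: resolvent_diag_le. Qed.

(** The resolvent identity between [z] and [z']. *)
Lemma stieltjes_lipschitz z z' (eta : R) : 0 < eta ->
  eta <= complex.Im z -> eta <= complex.Im z' ->
  cabs (stieltjes z - stieltjes z') <= N%:R / eta ^+ 2 * cabs (z - z').
Proof.
move=> eta0 hz hz'.
have z0 := lt_le_trans eta0 hz; have z0' := lt_le_trans eta0 hz'.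
have e : resolvent X z - resolvent X z' =
    (z - z') *: (resolvent X z *m resolvent X z').
  have -> : resolvent X z - resolvent X z' =
     resolvent X z *m ((X - z'%:M) - (X - z%:M)) *m resolvent X z'.
    by rewrite mulmxBr mulmxBl -mulmxA shiftV// mulmx1 Vshift// mul1mx.
  have -> : (X - z'%:M) - (X - z%:M) = (z - z')%:M.
    by rewrite opprB addrC subrKA raddfB.
  by rewrite mul_mx_scalar -scalemxAl.
rewrite /stieltjes -mulrBr -raddfB e /= mxtraceZ mulrCA Normc.normcM mulrC.
rewrite ler_wpM2r ?cabs_ge0//; apply: cabs_avg_le => i; rewrite mxE.
apply: (le_trans (cabs_sum _ _)).
have -> : N%:R / eta ^+ 2 = \sum_(j < N) (eta^-1 * eta^-1).
  by rewrite sumr_const card_ord [LHS]mulr_natl expr2 invfM.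
apply: ler_sum => j _; rewrite Normc.normcM.
apply: ler_pM; rewrite ?cabs_ge0//.
  by apply: (le_trans (resolvent_le hX z0 i j)); rewrite lef_pV2.
by apply: (le_trans (resolvent_le hX z0' j i)); rewrite lef_pV2.
Qed.

Lemma diagG_avg z : stieltjes z = N%:R^-1 * \sum_i diagG X z i.
Proof.
congr (_ * _); apply: eq_bigr => i _.
by rewrite /diagG evec_full full_evec !mxE.
Qed.

(** What has to be added to [z + s] to make the Schur complement formula
    exact. *)
Definition self_error z i : R[i] := Qerr X z i + (hatG X z i - stieltjes z).

Lemma diagG_self_consistent z i : 0 < complex.Im z ->
  diagG X z i = - (z + stieltjes z + self_error z i)^-1.
Proof.
move=> z0; rewrite diagGE// schur_denomE// -invrN; congr (_^-1); congr (- _).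
by rewrite /self_error; ring.
Qed.

Lemma hatG_stieltjes z i : 0 < complex.Im z ->
  cabs (hatG X z i - stieltjes z) <= (N%:R * complex.Im z)^-1.
Proof.
move=> z0; rewrite /hatG /stieltjes -mulrBr Normc.normcM Normc.normcV cabs_nat.
rewrite invfM ler_pM2l ?invr_gt0//.
by rewrite -cabsN opprB; exact: trace_diff_le.
Qed.

Lemma minor_hsnorm z i : 0 < complex.Im z ->
  (hsnorm (minor_resolvent X z i) / Num.sqrt N%:R) ^+ 2 =
  complex.Im (hatG X z i) / complex.Im z.
Proof.
move=> z0; rewrite exprMn hsnorm_resolvent//; last exact: minor_herm.
rewrite exprVn sqr_sqrtr ?ler0n// /hatG.
have -> : (N%:R^-1 : R[i]) = (N%:R^-1)%:C by rewrite fmorphV rmorph_nat.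
by rewrite ImZ; ring.
Qed.

(** With [a = sqrt N] and [b = sqrt eta], the Ward identity bounds the maximum
    by [5 / b], since [Im hatG_i <= 3] and [b <= 5]; this gives [5 K / (a b)]
    for [Q_i].  Replacing [hatG_i] by the trace costs [(a b)^-2], which is at
    most [K / (a b)]. *)
Lemma self_error_le z i (K : R) : 0 < complex.Im z <= 20 -> 1 <= K ->
  1 <= N%:R * complex.Im z -> cabs (stieltjes z) <= 9 / 8 ->
  cabs (Qerr X z i) <= K * ((Num.sqrt N%:R)^-1 *
     Num.max 1 (hsnorm (minor_resolvent X z i) / Num.sqrt N%:R)) ->
  cabs (self_error z i) <= 6 * K / Num.sqrt (N%:R * complex.Im z).
Proof.
move=> /andP[z0 z20] K1 Nz hs hQ.
have hG := hatG_stieltjes i z0; have hh := minor_hsnorm i z0.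
set x := hsnorm _ / _ in hQ hh.
have ihG : complex.Im (hatG X z i) <= 3.
  apply: (le_trans (ler_norm _)); apply: (le_trans (Im_le_cabs _)).
  have : (N%:R * complex.Im z)^-1 <= 1 by rewrite invf_le1//; lra.
  have := cabsD (hatG X z i - stieltjes z) (stieltjes z); rewrite subrK; lra.
rewrite sqrtrM ?ler0n//.
have a0 : 0 < Num.sqrt N%:R :> R by rewrite sqrtr_gt0.
have b0 : 0 < Num.sqrt (complex.Im z) by rewrite sqrtr_gt0.
have b2 : Num.sqrt (complex.Im z) ^+ 2 = complex.Im z by rewrite sqr_sqrtr ?ltW.
have a2 : Num.sqrt N%:R ^+ 2 = N%:R :> R by rewrite sqr_sqrtr ?ltW.
move: (Num.sqrt N%:R) (Num.sqrt (complex.Im z)) a0 b0 a2 b2 hQ => a b a0 b0 a2 b2 hQ.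
have ab0 : 0 < a * b by rewrite mulr_gt0.
have ab1 : 1 <= a * b.
  have : 1 <= (a * b) ^+ 2 by rewrite exprMn a2 b2.
  nra.
have hmax : Num.max 1 x <= 5 / b.
  rewrite ge_max ler_pdivlMr// mul1r; apply/andP; split; first nra.
  rewrite ler_pdivlMr//; have : (x * b) ^+ 2 <= 3.
    by rewrite exprMn hh b2 divfK ?gt_eqF.
  nra.
rewrite ler_pdivlMr//.
have h1 : cabs (hatG X z i - stieltjes z) * (a * b) <= 1.
  rewrite -ler_pdivlMr// mul1r; apply: (le_trans hG).
  rewrite -a2 -b2 -exprMn lef_pV2 ?posrE ?exprn_gt0//; nra.
have h2 : cabs (Qerr X z i) * (a * b) <= 5 * K.
  have -> : 5 * K = K * (a^-1 * (5 / b)) * (a * b) by field; rewrite !gt_eqF.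
  rewrite ler_wpM2r ?(ltW ab0)//; apply: (le_trans hQ).
  by rewrite ler_wpM2l ?ler_wpM2l ?invr_ge0 ?(ltW a0)//; lra.
have h3 : cabs (self_error z i) <= cabs (Qerr X z i) + cabs (hatG X z i - stieltjes z).
  exact: cabsD.
have := ler_wpM2r (ltW ab0) h3; lra.
Qed.

Lemma Qerr_frakK z i : cabs (Qerr X z i) <= frakK X z * ((Num.sqrt N%:R)^-1 *
     Num.max 1 (hsnorm (minor_resolvent X z i) / Num.sqrt N%:R)).
Proof.
rewrite -ler_pdivrMr; first exact: le_bigmax.
by rewrite mulr_gt0 ?invr_gt0 ?sqrtr_gt0// lt_max ltr01.
Qed.

Lemma frakK_ge1 z : 1 <= frakK X z.
Proof. exact: bigmax_ge_id. Qed.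

Lemma Qerr_bounded (eta : R) : 0 < eta -> exists B : R, forall z i,
  eta <= complex.Im z -> cabs (Qerr X z i) <= B.
Proof.
move=> eta0.
pose B i : R := \sum_j \sum_k cabs (offrow X i 0 j) * eta^-1 * cabs (offrow X i 0 k)
   + cabs (X i i) + eta^-1.
exists (\big[Num.max/0]_i B i) => z i hz; apply: le_trans (le_bigmax _ _ i).
have z0 := lt_le_trans eta0 hz.
have hS j k : cabs (minor_resolvent X z i j k) <= eta^-1.
  apply: (le_trans (resolvent_le (minor_herm i hX) z0 j k)).
  by rewrite lef_pV2.
rewrite QerrE// /B; apply: (le_trans (cabsB _ _)); apply: lerD.
  apply: (le_trans (cabsB _ _)); rewrite lerD2r.
  move: (offrow X i) (minor_resolvent X z i) hS => r S hS.
  rewrite -mulmxA mxE.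
  apply: (le_trans (cabs_sum _ _)); apply: ler_sum => j _.
  rewrite mxE mulr_sumr; apply: (le_trans (cabs_sum _ _)); apply: ler_sum => k _.
  rewrite !Normc.normcM !mxE cabs_conj mulrA.
  by rewrite ler_wpM2r ?ler_wpM2l ?cabs_ge0.
rewrite /hatG Normc.normcM Normc.normcV cabs_nat ler_pdivrMl//.
apply: (le_trans (cabs_sum _ _)).
apply: (@le_trans _ _ (\sum_(j < N.-1) eta^-1)).
  by apply: ler_sum => j _.
rewrite sumr_const card_ord -[leLHS]mulr_natl ler_wpM2r ?invr_ge0 ?(ltW eta0)//.
by rewrite ler_nat leq_pred.
Qed.

Lemma frakK_has_sup : has_sup (frakK_range X).
Proof.
split.
  exists (frakK X 'i), 'i => //; split => /=.
  - by rewrite /upper_half_plane /= ltr01.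
  - by rewrite normr0.
  - apply/andP; split; last by rewrite /tau; lra.
    by rewrite invf_le1// ler1n.
have n0 : 0 < (N%:R : R)^-1 by rewrite invr_gt0.
have [B hB] := Qerr_bounded n0.
have s0 : 0 < Num.sqrt N%:R :> R by rewrite sqrtr_gt0.
exists (Num.max 1 (B * Num.sqrt N%:R)) => _ [z [_ _ /andP[hz _]] <-].
apply: bigmax_le => [|i _]; first by rewrite le_max lexx.
rewrite le_max; apply/orP; right.
rewrite ler_pdivrMr; last by rewrite mulr_gt0 ?invr_gt0// lt_max ltr01.
apply: (le_trans (hB z i hz)).
have B0 : 0 <= B by apply: le_trans (hB z i hz); exact: cabs_ge0.
rewrite -mulrA mulVKf ?gt_eqF//.
by rewrite ler_peMr// le_max lexx.
Qed.

End Stieltjes.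

(** * Continuity in the spectral parameter *)

Section Ray.
Variable R : realType.

Lemma min_lipschitz (a b a' b' c : R) : `|a - a'| <= c -> `|b - b'| <= c ->
  `|Num.min a b - Num.min a' b'| <= c.
Proof.
rewrite !ler_norml => /andP[h1 h2] /andP[h3 h4].
by case: (ltrP a b) => h; case: (ltrP a' b') => h'; apply/andP; split; lra.
Qed.

Lemma cabs_lipschitz (x y : R[i]) : `|cabs x - cabs y| <= cabs (x - y).
Proof.
have h1 := cabsD (x - y) y; have h2 := cabsD (y - x) x.
rewrite !subrK -(cabsN (y - x)) opprB in h1 h2.
by rewrite ler_norml; apply/andP; split; lra.
Qed.

Lemma edge_h_lipschitz (z w : R[i]) : `|edge_h z - edge_h w| <= cabs (z - w).
Proof.
apply: min_lipschitz; first by rewrite subrr normr0 cabs_ge0.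
by apply: min_lipschitz; apply: (le_trans (cabs_lipschitz _ _));
  rewrite le_eqVlt; apply/orP; left; apply/eqP; congr cabs; ring.
Qed.

Lemma lipschitz_within_continuous (f : R -> R) (a b L : R) :
  (forall x y, a <= x <= b -> a <= y <= b -> `|f x - f y| <= L * `|x - y|) ->
  {within `[a, b], continuous f}.
Proof.
move=> hf; apply/subspace_continuousP => x /=; rewrite in_itv /= => hx.
apply/cvgrPdist_le => e e0 /=.
have L0 : 0 < `|L| + 1 by rewrite ltr_wpDl.
rewrite near_withinE; near=> y; rewrite /= in_itv /= => hy.
apply: (le_trans (hf x y hx hy)).
apply: (@le_trans _ _ ((`|L| + 1) * `|x - y|)).
  by rewrite ler_wpM2r//; have := ler_norm L; lra.
rewrite -ler_pdivlMl//.
near: y; apply: (@cvgr_dist_le _ _ _ (nbhs x) _ id x); first exact: cvg_id.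
by rewrite mulrC divr_gt0.
Unshelve. all: by end_near.
Qed.

(** The balls of [R[i]^o] have complex radii; those of positive real radius
    are enough to detect closedness. *)
Lemma closed_complex (A : set R[i]) :
  (forall z, (forall d : R, 0 < d -> exists2 w, A w & cabs (z - w) < d) -> A z) ->
  closed (A : set R[i]^o).
Proof.
move=> hA z hz; apply: hA => d d0.
have dC : 0 < d%:C :> R[i] by rewrite ltcR.
have [w [Aw]] := hz _ (nbhsx_ballx (z : R[i]^o) _ dC).
rewrite -ball_normE /= => hw; exists w => //.
by move: hw; rewrite normc_def ltcR; case: (z - w).
Qed.

(** A one-sided Lipschitz bound is enough for a lower bound to pass to limit
    points. *)
Lemma le_limit (A : set R[i]) (f : R[i] -> R) (z : R[i]) (c L : R) : 0 <= L ->
  (forall d : R, 0 < d -> exists2 w, A w & cabs (z - w) < d) ->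
  (forall w, A w -> c <= f w) ->
  (forall w, cabs (z - w) <= 1 -> f w <= f z + L * cabs (z - w)) -> c <= f z.
Proof.
move=> L0 hz hA hf; apply/ler_addgt0Pr => e e0.
have L1 : 0 < L + 1 by lra.
have d0 : 0 < Num.min 1 (e / (L + 1)) by rewrite lt_min ltr01 divr_gt0.
have [w Aw] := hz _ d0; rewrite lt_min ltr_pdivlMr// => /andP[w1 w2].
have := hA w Aw; have := hf w (ltW w1); have := cabs_ge0 (z - w); nra.
Qed.

Lemma calX_closed N (X : 'M[R[i]]_N) : (0 < N)%N -> closed (calX X : set R[i]^o).
Proof.
move=> N0; apply: closed_complex => z hz.
have lim := le_limit _ hz.
have hIm w : complex.Im w <= complex.Im z + 1 * cabs (z - w).
  have := Im_le_cabs (z - w); rewrite ImB ler_norml => /andP[]; lra.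
have hIm' w : - complex.Im w <= - complex.Im z + 1 * cabs (z - w).
  have := Im_le_cabs (z - w); rewrite ImB ler_norml => /andP[]; lra.
have hRe w : complex.Re w <= complex.Re z + 1 * cabs (z - w).
  have := Re_le_cabs (z - w); rewrite ReB ler_norml => /andP[]; lra.
have hRe' w : - complex.Re w <= - complex.Re z + 1 * cabs (z - w).
  have := Re_le_cabs (z - w); rewrite ReB ler_norml => /andP[]; lra.
have i1 : N%:R^-1 <= complex.Im z.
  apply: (lim (@complex.Im R) _ 1) => // w [[_ _ /andP[]]] //.
have i2 : - tau R <= - complex.Im z.
  by apply: (lim (fun w => - complex.Im w) _ 1) => // w [[_ _ /andP[]]]; rewrite lerN2.
have i3 : - 4 <= complex.Re z.
  by apply: (lim (@complex.Re R) _ 1) => // w [[_ ]]; rewrite ler_norml => /andP[].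
have i4 : - 4 <= - complex.Re z.
  apply: (lim (fun w => - complex.Re w) _ 1) => // w [[_ ]].
  by rewrite ler_norml lerN2 => /andP[].
have z0 : 0 < complex.Im z by apply: lt_le_trans i1; rewrite invr_gt0 ltr0n.
split.
  split => //; first by rewrite ler_norml i3 -lerN2.
  by rewrite i1 -lerN2.
apply: (lim (fun w => edge_h w ^+ 2 * complex.Im w) _ (2 * (complex.Im z + 1) + 1)).
- lra.
- by move=> w [].
move=> w w1.
have h1 := hIm w; have h2 := edge_h_lipschitz z w.
have /andP[a0 a1] := edge_h01 z; have /andP[b0 b1] := edge_h01 w.
have d0 := cabs_ge0 (z - w).
move: (cabs (z - w)) (edge_h z) (edge_h w) w1 d0 h2 a0 a1 b0 b1 h1 => d a b.
move: (complex.Im z) (complex.Im w) z0 => y x y0 d1 d0; rewrite ler_norml => /andP[ab1 ab2] a0 a1 b0 b1 xy.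
have e1 : b ^+ 2 <= a ^+ 2 + 2 * d by nra.
have e2 : b ^+ 2 * x <= b ^+ 2 * (y + d) by rewrite ler_wpM2l ?sqr_ge0//; lra.
have e3 : b ^+ 2 * (y + d) <= (a ^+ 2 + 2 * d) * (y + d) by rewrite ler_wpM2r//; lra.
have e4 : a ^+ 2 * d <= d by rewrite ler_piMl// expr_le1.
have e5 : d * d <= d by rewrite ler_piMl.
have e6 : (a ^+ 2 + 2 * d) * (y + d) =
    a ^+ 2 * y + 2 * (d * y) + a ^+ 2 * d + 2 * (d * d) by ring.
lra.
Qed.

(** * Propagation along vertical rays *)

Section Law.
Variables (N : nat) (X : 'M[R[i]]_N) (K : R).
Hypotheses (hN : (0 < N)%N) (hX : X ^t* = X) (K1 : 1 <= K).

Let nR : 0 < (N%:R : R). Proof. by rewrite ltr0n. Qed.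

Lemma theta_ge : 64 <= theta R.
Proof.
rewrite /theta (_ : 64 = 2 ^+ 6); last by ring.
by apply: ler_weXn2l => //; lra.
Qed.

(** What the estimates below use at a single point: [K] is any upper bound for
    [frakK] there, in place of the supremum over the whole region. *)
Definition edge_admissible (z : R[i]) : Prop :=
  [/\ 0 < complex.Im z, complex.Im z <= 20, frakK X z <= K &
   2 ^+ 8 * theta R ^+ 2 * K ^+ 2 / N%:R <= edge_h z ^+ 2 * complex.Im z].

(** The square root of the defining inequality, with [16 theta >= 1024]. *)
Lemma admissible_scale z : edge_admissible z ->
  1024 * K <= edge_h z * Num.sqrt (N%:R * complex.Im z).
Proof.
move=> [z0 _ _ hc]; have /andP[h0 h1] := edge_h01 z; have th := theta_ge.
have W0 : 0 <= Num.sqrt (N%:R * complex.Im z) := sqrtr_ge0 _.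
have W2 : Num.sqrt (N%:R * complex.Im z) ^+ 2 = N%:R * complex.Im z.
  by rewrite sqr_sqrtr// mulr_ge0// ltW.
move: (Num.sqrt _) W0 W2 => W W0 W2.
have e : (16 * theta R * K) ^+ 2 <= (edge_h z * W) ^+ 2.
  rewrite [leRHS]exprMn W2; rewrite ler_pdivrMr// in hc.
  have -> : (16 * theta R * K) ^+ 2 = 2 ^+ 8 * theta R ^+ 2 * K ^+ 2 by ring.
  by apply: (le_trans hc); rewrite le_eqVlt; apply/orP; left; apply/eqP; ring.
have : 16 * theta R * K <= edge_h z * W.
  rewrite -(@ler_pXn2r _ 2%N)// nnegrE; last exact: mulr_ge0.
  by rewrite !mulr_ge0 ?(le_trans ler01 K1) ?(le_trans (ler0n _ 64) th).
have : 64 * K <= theta R * K by rewrite ler_wpM2r// (le_trans ler01 K1).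
by move=> {hc e W2 th} t1 t2; lra.
Qed.

Lemma admissible_pos z : edge_admissible z ->
  0 < Num.sqrt (N%:R * edge_h z * complex.Im z).
Proof.
move=> hz; have hs := admissible_scale hz; case: hz => z0 _ _ _.
have /andP[h0 _] := edge_h01 z; have k1 := K1.
rewrite sqrtr_gt0 !mulr_gt0 ?ltr0n// lt_neqAle h0 andbT eq_sym.
by apply/eqP => h; rewrite h mul0r in hs; lra.
Qed.

(** This is [self_consistent_stability] for errors of size
    [6 K / sqrt (N eta)], with both sides multiplied by [sqrt (N eta)]. *)
Lemma admissible_step z : edge_admissible z ->
  cabs (stieltjes X z - semicircle_m z) <= Num.sqrt (edge_h z) / 8 ->
  cabs (stieltjes X z - semicircle_m z) * Num.sqrt (N%:R * edge_h z * complex.Im z)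
    <= 12 * K /\
  forall i, cabs (diagG X z i - semicircle_m z) *
     Num.sqrt (N%:R * edge_h z * complex.Im z) <= 24 * K.
Proof.
move=> hz weak; have hs := admissible_scale hz.
case: hz => z0 z20 hK _.
have /andP[h0 h1] := edge_h01 z.
have [m0 m1 mi hm] := semicircle_spec z0.
have ww := sqrt_edge_le z0.
have w2 : Num.sqrt (edge_h z) ^+ 2 = edge_h z by rewrite sqr_sqrtr.
have W0 : 0 <= Num.sqrt (N%:R * complex.Im z) := sqrtr_ge0 _.
have W2 : Num.sqrt (N%:R * complex.Im z) ^+ 2 = N%:R * complex.Im z.
  by rewrite sqr_sqrtr// mulr_ge0// ltW.
have -> : Num.sqrt (N%:R * edge_h z * complex.Im z) =
    Num.sqrt (edge_h z) * Num.sqrt (N%:R * complex.Im z).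
  by rewrite -sqrtrM//; congr Num.sqrt; ring.
have WK : 1024 * K <= Num.sqrt (N%:R * complex.Im z) by nra.
have k1 := K1.
have W1 : 1 <= Num.sqrt (N%:R * complex.Im z) by lra.
have Nz : 1 <= N%:R * complex.Im z by rewrite -W2 expr_ge1.
have w01 : 0 < Num.sqrt (edge_h z) <= 1.
  rewrite sqrtr_gt0; apply/andP; split; first by nra.
  have := sqrtr_ge0 (edge_h z); nra.
have se i : cabs (self_error X z i) <= 6 * K / Num.sqrt (N%:R * complex.Im z).
  apply: self_error_le => //; first by rewrite z0.
    have := cabsD (stieltjes X z - semicircle_m z) (semicircle_m z).
    rewrite subrK; lra.
  apply: (le_trans (Qerr_frakK X hN z i)).
  rewrite ler_wpM2r// mulr_ge0 ?invr_ge0 ?sqrtr_ge0//.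
  by rewrite le_max ler01.
have W00 : 0 < Num.sqrt (N%:R * complex.Im z) by lra.
have eps8 : 6 * K / Num.sqrt (N%:R * complex.Im z) <= 1 / 8.
  by rewrite ler_pdivrMr//; lra.
have [c1 c2] := self_consistent_stability hN m0 (ltW m1) hm w01 ww
  (diagG_avg X z) (fun i => diagG_self_consistent hX i z0) se eps8 weak.
have e c : c * (6 * K / Num.sqrt (N%:R * complex.Im z)) * Num.sqrt (N%:R * complex.Im z)
  = c * 6 * K by field; rewrite gt_eqF.
split; first by have := ler_wpM2r W0 c1; rewrite e; lra.
by move=> i; have := ler_wpM2r W0 (c2 i); rewrite e; lra.
Qed.

(** If [|s - m|] were equal to [sqrt h / 8], then [admissible_step] would bound
    [h sqrt (N eta)] by [96 K], against the lower bound [1024 K]. *)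
Lemma admissible_gap z : edge_admissible z ->
  64 * cabs (stieltjes X z - semicircle_m z) ^+ 2 != edge_h z.
Proof.
move=> hz; apply/eqP => hE.
have /andP[h0 h1] := edge_h01 z.
have u0 := cabs_ge0 (stieltjes X z - semicircle_m z).
have w2 : Num.sqrt (edge_h z) ^+ 2 = edge_h z by rewrite sqr_sqrtr.
have w0 := sqrtr_ge0 (edge_h z).
have E : cabs (stieltjes X z - semicircle_m z) = Num.sqrt (edge_h z) / 8.
  apply/eqP; rewrite -(@eqrXn2 _ 2%N) ?divr_ge0//.
  by apply/eqP; rewrite exprMn w2 -hE; field.
have weak : cabs (stieltjes X z - semicircle_m z) <= Num.sqrt (edge_h z) / 8 by rewrite E.
have [c _] := admissible_step hz weak.
have k1 := K1; have hs := admissible_scale hz; case: hz => z0 _ _ _.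
have e : Num.sqrt (N%:R * edge_h z * complex.Im z) =
    Num.sqrt (edge_h z) * Num.sqrt (N%:R * complex.Im z).
  by rewrite -sqrtrM//; congr Num.sqrt; ring.
move: c; rewrite E e mulrAC mulrA -expr2 w2; lra.
Qed.

(** At this height the resolvent and [m] are at most [1 / 20], and [h = 1]. *)
Lemma initial_estimate (x : R) (z := x +i* 20) :
  64 * cabs (stieltjes X z - semicircle_m z) ^+ 2 < edge_h z.
Proof.
have z0 : 0 < complex.Im z by rewrite /=; lra.
have h1 : edge_h z = 1.
  have big (c : R[i]) : complex.Im c = 20 -> 1 <= cabs c.
    by move=> e; apply: le_trans (Im_le_cabs _); rewrite e ger0_norm; lra.
  rewrite /edge_h; apply/min_idPl; rewrite le_min.
  have i2 : complex.Im (2 : R[i]) = 0 by rewrite -(rmorph_nat (real_complex R)).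
  have b1 : 1 <= cabs (z + 2) by apply: big; rewrite ImD i2 addr0.
  have b2 : 1 <= cabs (z - 2) by apply: big; rewrite ImB i2 subr0.
  by rewrite b1 b2.
have hs := stieltjes_le hN hX z0.
have hm : cabs (semicircle_m z) <= 1 / 20.
  have := congr1 (@cabs R) (semicircle_eq z0); rewrite Normc.normcM cabsN Normc.normc1.
  have [_ _ mi _] := semicircle_spec z0.
  have : 20 <= cabs (z + semicircle_m z).
    apply: le_trans (Im_le_cabs _); rewrite ImD -[complex.Im z]/20.
    move: (complex.Im (semicircle_m z)) mi => y y0; rewrite ger0_norm; lra.
  have := cabs_ge0 (semicircle_m z); nra.
rewrite /= in hs.
have := cabsB (stieltjes X z) (semicircle_m z).
have := cabs_ge0 (stieltjes X z - semicircle_m z).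
rewrite h1 => u0 u1; have : cabs (stieltjes X z - semicircle_m z) <= 1 / 10 by lra.
nra.
Qed.

Lemma ray_continuous (x eta : R) : 0 < eta ->
  {within `[eta, 20], continuous (fun t : R =>
     64 * cabs (stieltjes X (x +i* t) - semicircle_m (x +i* t)) ^+ 2
       - edge_h (x +i* t))}.
Proof.
move=> eta0.
(* [c] bounds [|s - m|] on the ray and [L] is a Lipschitz constant of [s - m]. *)
pose c := eta^-1 + 1; pose L := N%:R / eta ^+ 2 + eta^-1.
have key (u v h k d : R) : 0 <= u -> 0 <= v -> u <= c -> v <= c ->
    `|u - v| <= L * d -> `|h - k| <= d ->
    `|64 * u ^+ 2 - h - (64 * v ^+ 2 - k)| <= (64 * (2 * c * L) + 1) * d.
  move=> u0 v0 hu hv huv hhk.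
  have -> : 64 * u ^+ 2 - h - (64 * v ^+ 2 - k) =
    64 * ((u + v) * (u - v)) - (h - k) by ring.
  apply: (le_trans (ler_normB _ _)); rewrite [leRHS]mulrDl mul1r; apply: lerD => //.
  rewrite normrM (ger0_norm (_ : 0 <= 64))// -mulrA ler_wpM2l//.
  rewrite normrM (ger0_norm (addr_ge0 u0 v0)) -mulrA.
  by apply: ler_pM; rewrite ?addr_ge0//; lra.
apply: (@lipschitz_within_continuous _ _ _ (64 * (2 * c * L) + 1)).
move=> s t /andP[s0 _] /andP[t0 _].
have dz : cabs (x +i* s - x +i* t) = `|s - t|.
  by rewrite /= subrr expr0n add0r sqrtr_sqr.
have bnd r : eta <= r -> cabs (stieltjes X (x +i* r) - semicircle_m (x +i* r)) <= c.
  move=> hr; have r0 : 0 < complex.Im (x +i* r) by apply: lt_le_trans hr.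
  apply: (le_trans (cabsB _ _)); apply: lerD.
    by apply: (le_trans (stieltjes_le hN hX r0)); rewrite lef_pV2.
  by have [_ /ltW] := semicircle_spec r0.
have hu := bnd s s0; have hv := bnd t t0.
have hL : `|cabs (stieltjes X (x +i* s) - semicircle_m (x +i* s)) -
     cabs (stieltjes X (x +i* t) - semicircle_m (x +i* t))| <= L * `|s - t|.
  apply: (le_trans (cabs_lipschitz _ _)); rewrite -dz /L mulrDl.
  have e (a b c' d : R[i]) : a - b - (c' - d) = (a - c') - (b - d) by ring.
  rewrite e; apply: (le_trans (cabsB _ _)); apply: lerD.
    exact: stieltjes_lipschitz.
  exact: semicircle_lipschitz.
have hh := edge_h_lipschitz (x +i* s) (x +i* t); rewrite dz in hh.
have u0 := cabs_ge0 (stieltjes X (x +i* s) - semicircle_m (x +i* s)).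
have v0 := cabs_ge0 (stieltjes X (x +i* t) - semicircle_m (x +i* t)).
exact: key u0 v0 hu hv hL hh.
Qed.

Lemma edge_h_mono (x s t : R) : 0 <= s -> s <= t -> edge_h (x +i* s) <= edge_h (x +i* t).
Proof.
move=> s0 st; rewrite /edge_h.
have mono (y : R) : cabs (y +i* s) <= cabs (y +i* t).
  rewrite /= ler_wsqrtr// lerD2l ler_pXn2r ?nnegrE//; lra.
have e (y : R) r : x +i* r + y%:C = (x + y) +i* r.
  by apply/eqP; rewrite eq_complex /= eqxx addr0 eqxx.
have e2 r : x +i* r + 2 = (x + 2) +i* r by rewrite -e rmorph_nat.
have e3 r : x +i* r - 2 = (x - 2) +i* r by rewrite -e rmorphN rmorph_nat.
by rewrite !e2 !e3 !le_min !ge_min lexx !mono !orbT.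
Qed.

Lemma admissible_law z :
  (forall t, complex.Im z <= t <= 20 -> edge_admissible (complex.Re z +i* t)) ->
  0 < complex.Im z <= 20 ->
  forall i, cabs (diagG X z i - semicircle_m z) *
    Num.sqrt (N%:R * edge_h z * complex.Im z) <= 24 * K.
Proof.
case: z => x eta /= adm /andP[eta0 eta20].
have adm0 : edge_admissible (x +i* eta) by apply: adm; rewrite lexx.
pose f (t : R) := 64 * cabs (stieltjes X (x +i* t) - semicircle_m (x +i* t)) ^+ 2
       - edge_h (x +i* t).
have f20 : f 20 < 0 by rewrite subr_lt0; exact: initial_estimate.
have feta : f eta < 0.
  rewrite ltNge; apply/negP => fe.
  have [] := @IVT _ f eta 20 0 eta20 (@ray_continuous x eta eta0).
    by rewrite ge_min le_max fe (ltW f20) orbT.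
  move=> t; rewrite in_itv /= => ht /eqP; rewrite subr_eq0.
  by apply/negP; apply: admissible_gap; exact: adm.
suff weak : cabs (stieltjes X (x +i* eta) - semicircle_m (x +i* eta))
    <= Num.sqrt (edge_h (x +i* eta)) / 8 by exact: (admissible_step adm0 weak).2.
have /andP[h0 _] := edge_h01 (x +i* eta).
have w2 : Num.sqrt (edge_h (x +i* eta)) ^+ 2 = edge_h (x +i* eta) by rewrite sqr_sqrtr.
have w0 := sqrtr_ge0 (edge_h (x +i* eta)).
rewrite -(@ler_pXn2r _ 2%N)// ?nnegrE ?cabs_ge0 ?divr_ge0//.
rewrite exprMn w2; move: feta; rewrite /f; lra.
Qed.

End Law.
End Ray.

(** * The local law *)

Theorem theorem9p2 (R : realType) (N : nat) (hN : (2 <= N)%N)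
    (X : 'M[R[i]]_N) (hX : X \is hermsymmx) :
  [/\ has_sup (frakK_range X),
      closed (calX X : set R[i]^o) &
      forall z : R[i], calX X z ->
        \big[Num.max/0]_(i < N) cabs (diagG X z i - semicircle_m z)
          <= theta R * supK X / Num.sqrt (N%:R * edge_h z * complex.Im z)].
Proof.
have N0 : (0 < N)%N by apply: leq_trans hN.
have {hX} hH := hermsymmxE hX.
have hsup := frakK_has_sup N0 hH.
split => //; first exact: calX_closed.
move=> z [hz hc]; have K1 : 1 <= supK X.
  apply: (@le_trans _ _ (frakK X z)); first exact: frakK_ge1.
  by apply: ub_le_sup; [exact: hsup.2|exists z].
case: (hz) => z0 zRe /andP[zN z20].
have adm t : complex.Im z <= t <= 20 -> edge_admissible X (supK X) (complex.Re z +i* t).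
  move=> /andP[zt t20]; have t0 : 0 < t := lt_le_trans z0 zt.
  split => //=.
    apply: ub_le_sup; first exact: hsup.2.
    exists (complex.Re z +i* t) => //; split => //=.
    by rewrite (le_trans zN zt).
  apply: (le_trans hc); apply: ler_pM => //; first exact: sqr_ge0.
    exact: ltW.
  have hmono : edge_h z <= edge_h (complex.Re z +i* t).
    rewrite [z in edge_h z](_ : z = complex.Re z +i* complex.Im z); last by case: (z).
    by apply: edge_h_mono => //; exact: ltW.
  have /andP[h0 _] := edge_h01 z; have /andP[h0' _] := edge_h01 (complex.Re z +i* t).
  by rewrite ler_pXn2r.
have z20' : 0 < complex.Im z <= 20 by apply/andP; split.
have law := admissible_law N0 hH K1 adm z20'.
have adm0 : edge_admissible X (supK X) z.
  have := adm (complex.Im z); rewrite lexx => /(_ z20); case: (z) => //.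
have q0 := admissible_pos N0 K1 adm0.
have th := theta_ge R.
move: (theta R) th => th th64 {hc}.
have th0 : 0 <= th by apply: le_trans th64.
have K0 : 0 <= supK X by apply: le_trans K1.
apply: bigmax_le => [|i _]; first by rewrite divr_ge0 ?(ltW q0)// mulr_ge0.
rewrite ler_pdivlMr//; apply: (le_trans (law i)).
apply: ler_wpM2r => //; apply: le_trans th64; by rewrite ler_nat.
Qed.
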